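(* There is a constant $c>0$ depending only on $d$ such that for every finite nonempty set $A\subset\mathbb{Z}^{d}$, $$\sup_{z\in\mathbb{R}}\left|\mathbb{P}\left(\frac{M(A)}{g(0)}-\log|A|\le z\right)-\exp(-e^{-z})\right|\le c|A|^{-c_{1}}.$$ In particular, $\frac{M(A)}{g(0)}-\log|A|$ tends in distribution to the Gumbel distribution (the law with cumulative distribution function $z\mapsto\exp(-e^{-z})$), as $|A|\to\infty$.
   Context: Throughout $d\ge 3$; $|A|$ denotes the cardinality of a set $A$. $P_x$ is the law of simple random walk $(X_n)_{n\ge0}$ on $\mathbb{Z}^d$ started at $x$. The Green's function is $g(x,y)=\sum_{n\ge0}P_x(X_n=y)$ and $g(\cdot)=g(\cdot,0)$. For a finite set $K\subset\mathbb{Z}^d$ let $\tilde H_K=\inf\{n\ge1: X_n\in K\}$, $e_K(x)=P_x(\tilde H_K=\infty)1_K(x)$, and $\operatorname{cap}(K)=\sum_{x\in K}e_K(x)$. The constant $c_1>0$ is $c_1=\frac14\min\left(\frac{1}{14}\frac{d-2}{d-1},\frac{c_2}{9-c_2}\right)$, where $c_2=P_0(\tilde H_{\{0\}}=\infty)$. Random interlacements. Let $W$ be the space of doubly infinite nearest-neighbor paths $w:\mathbb{Z}\to\mathbb{Z}^d$ that spend finite time in bounded subsets of $\mathbb{Z}^d$, and let $W^\star=W/\sim$, where $w\sim v$ if $w(\cdot)=v(\cdot+N)$ for some $N\in\mathbb{Z}$. Let $\nu$ be the unique $\sigma$-finite measure on $W^\star$ such that for every finite $K\subset\mathbb{Z}^d$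 the restriction of $\nu$ to the set of trajectories modulo time-shift that enter $K$ is the image under $W\to W^\star$ of the finite measure $Q_K$ on $W$ given by $Q_K[(w(-n))_{n\ge0}\in E, w(0)=x,(w(n))_{n\ge0}\in F]=P_x(E\mid\tilde H_K=\infty)\,e_K(x)\,P_x(F)$ (interpreted as $0$ if $e_K(x)=0$). Under $\mathbb{P}$, let $\omega=\sum_i\delta_{(w_i^\star,u_i)}$ be a Poisson point process on $W^\star\times[0,\infty)$ with intensity measure $\nu\otimes du$. The random interlacement at level $u\ge0$ is $\mathcal{I}^u=\bigcup_{i: u_i\le u}\operatorname{range}(w_i^\star)\subset\mathbb{Z}^d$, where $\operatorname{range}(w^\star)$ is the set of vertices visited by $w^\star$. For each $u$ its law is characterized by $\mathbb{P}(A\cap\mathcal{I}^u=\varnothing)=\exp(-u\operatorname{cap}(A))$ for all finite $A\subset\mathbb{Z}^d$. Cover levels: $U_x=\inf\{u\ge0: x\in\mathcal{I}^u\}$ for $x\in\mathbb{Z}^d$, and for finite $A$, $M(A)=\inf\{u\ge0: A\subset\mathcal{I}^u\}=\max_{x\in A}U_x$. *)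

(* Defs.v *)
From HB Require Import structures.
From mathcomp Require Import all_boot all_order all_algebra finmap.
From mathcomp Require Import all_classical all_reals all_analysis measurable_realfun.

Set Implicit Arguments.
Unset Strict Implicit.
Unset Printing Implicit Defensive.

Import Order.TTheory GRing.Theory Num.Theory.
Import numFieldNormedType.Exports.

Local Open Scope classical_set_scope.
Local Open Scope ring_scope.

HB.instance Definition _ := isPointed.Build int 0.

Notation lattice d := 'rV[int]_d.

Definition nearest_neighbour (d : nat) (x y : lattice d) : bool :=
  (\sum_(i < d) `|x ord0 i - y ord0 i| == 1 :> int).

(* One-sided paths, with the sigma-algebra generated by the coordinates (the
   lattice being countable, it suffices to generate by the sets {X_n = x}). *)
Definition path_cylinder (d : nat) : set (set (nat -> lattice d)) :=
  [set E | exists n x, E = [set X | X n = x]].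

Notation walk_path d := (g_sigma_algebraType (@path_cylinder d)).

Section SimpleRandomWalk.
Variables (R : realType) (d : nat).

(* A probability on paths is determined by its values on the events
   {X_0 = xs 0, ..., X_n = xs n}, so this condition characterizes the family
   (P_x)_x of laws of simple random walk. *)
Definition is_simple_random_walk
    (Px : lattice d -> probability (walk_path d) R) :=
  forall (x : lattice d) (xs : nat -> lattice d) (n : nat),
    Px x [set X | forall i, (i <= n)%N -> X i = xs i] =
    ((x == xs 0%N)%:R * \prod_(i < n)
       (if nearest_neighbour (xs i) (xs i.+1) then (2 * d)%N%:R^-1 else 0))%:E.

Variable Px : lattice d -> probability (walk_path d) R.

Definition green (x y : lattice d) : \bar R :=
  (\sum_(0 <= n <oo) Px x [set X : walk_path d | X n = y])%E.

(* The event that the hitting time inf {n >= 1 : X_n \in K} is infinite. *)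
Definition never_hits (K : {fset lattice d}) : set (walk_path d) :=
  [set X | forall n, (1 <= n)%N -> X n \notin K].

Definition equilibrium (K : {fset lattice d}) (x : lattice d) : R :=
  fine (Px x (never_hits K)) * (x \in K)%:R.

Definition c2 : R := fine (Px 0 (never_hits [fset 0]%fset)).

Definition c1 : R :=
  4^-1 * Num.min (14^-1 * ((d%:R - 2) / (d%:R - 1))) (c2 / (9 - c2)).

End SimpleRandomWalk.

(* Bounded subsets of the lattice are the finite ones. *)
Definition is_trajectory (d : nat) (w : int -> lattice d) :=
  (forall n, nearest_neighbour (w n) (w (n + 1))) /\
  (forall K : set (lattice d), finite_set K -> finite_set (w @^-1` K)).

(* The dimension bound is a (phantom) parameter of the space of trajectories: a
   measurableType has to be inhabited, and in dimension 0 the space is empty. *)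
Definition trajectory (d : nat) (hd : (3 <= d)%N) : Type :=
  {w : int -> lattice d | `[< is_trajectory w >]}.

Section Trajectories.
Variables (d : nat) (hd : (3 <= d)%N).

Local Notation W := (trajectory hd).

HB.instance Definition _ := gen_eqMixin W.
HB.instance Definition _ := gen_choiceMixin W.

Definition first_axis : 'I_d := Ordinal (leq_trans (isT : (0 < 3)%N) hd).

Definition straight_line (n : int) : lattice d := n *: delta_mx ord0 first_axis.

Lemma straight_lineP : is_trajectory straight_line.
Proof.
split=> [n|K finK].
- rewrite /nearest_neighbour (bigD1 first_axis) //= !mxE !eqxx /= !mulr1.
  rewrite opprD addrA subrr add0r normrN normr1 big1 ?addr0 // => i ii0.
  by rewrite !mxE eqxx /= (negbTE ii0) !mulr0 subrr normr0.
- apply: finite_preimage => // m n _ _.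
  move=> /(congr1 (fun x : lattice d => x ord0 first_axis)).
  by rewrite !mxE !eqxx /= !mulr1.
Qed.

HB.instance Definition _ :=
  isPointed.Build W
    (exist _ straight_line (asboolT straight_lineP) : W).

Definition W_cylinder : set (set W) :=
  [set E | exists n x, E = [set w : W | sval w n = x]].

HB.instance Definition _ := Measurable.copy W (g_sigma_algebraType W_cylinder).

Definition shift_equiv (w v : W) : bool :=
  `[< exists N : int, forall n, sval w n = sval v (n + N) >].

Lemma shift_equiv_refl : reflexive shift_equiv.
Proof. by move=> w; apply/asboolP; exists 0 => n; rewrite addr0. Qed.

Lemma shift_equiv_sym : symmetric shift_equiv.
Proof.
suff H w v : shift_equiv w v -> shift_equiv v w.
  by move=> w v; apply/idP/idP; exact: H.
move=> /asboolP [N wv]; apply/asboolP; exists (- N) => n.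
by rewrite wv subrK.
Qed.

Lemma shift_equiv_trans : transitive shift_equiv.
Proof.
move=> v w u /asboolP [N wv] /asboolP [M vu]; apply/asboolP.
by exists (N + M) => n; rewrite wv vu addrA.
Qed.

Canonical shift_equiv_rel :=
  EquivRel shift_equiv shift_equiv_refl shift_equiv_sym shift_equiv_trans.

Definition Wstar := {eq_quot shift_equiv_rel}%qT.
HB.instance Definition _ := Choice.on Wstar.
HB.instance Definition _ := Quotient.on Wstar.

Definition pi_star (w : W) : Wstar := (\pi_Wstar w)%qT.

HB.instance Definition _ := isPointed.Build Wstar (pi_star point).

(* The largest sigma-algebra on W* making the projection measurable. *)
Definition Wstar_measurable : set (set Wstar) :=
  image_set_system setT pi_star (@measurable _ W).

Lemma Wstar_sigma_algebra : sigma_algebra setT Wstar_measurable.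
Proof. exact/sigma_algebra_image/sigma_algebra_measurable. Qed.

Lemma Wstar_measurableC (A : set Wstar) :
  Wstar_measurable A -> Wstar_measurable (~` A).
Proof. by case: Wstar_sigma_algebra => _ + _ mA => /(_ _ mA); rewrite setTD. Qed.

Fact Wstar_display : measure_display. Proof. exact. Qed.

HB.instance Definition _ := @isMeasurable.Build Wstar_display Wstar
  Wstar_measurable (let: And3 h _ _ := Wstar_sigma_algebra in h) Wstar_measurableC
  (let: And3 _ _ h := Wstar_sigma_algebra in h).

Definition range_star (ws : Wstar) : set (lattice d) :=
  \bigcup_(w in [set w | pi_star w = ws]) range (sval w).

Definition entering (K : {fset lattice d}) : set Wstar :=
  [set ws | exists2 x, x \in K & range_star ws x].

Variable R : realType.

(* Conditional probabilities are written as quotients; when e_K x = 0 the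
   right-hand side vanishes. *)
Definition is_Q (Px : lattice d -> probability (walk_path d) R)
    (K : {fset lattice d}) (Q : set W -> \bar R) :=
  forall (E F : set (walk_path d)) (x : lattice d),
    measurable E -> measurable F ->
    Q [set w | [/\ E (fun n : nat => sval w (- n%:Z)), sval w 0 = x &
                   F (fun n : nat => sval w n%:Z)]] =
    (fine (Px x (E `&` never_hits K)) / fine (Px x (never_hits K)) *
     equilibrium Px K x * fine (Px x F))%:E.

Definition is_interlacement_measure
    (Px : lattice d -> probability (walk_path d) R) (nu : set Wstar -> \bar R) :=
  forall K : {fset lattice d}, exists2 Q : {finite_measure set W -> \bar R},
    is_Q Px K Q &
    forall B : set Wstar, measurable B ->
      nu (B `&` entering K) = pushforward Q pi_star B.

End Trajectories.


Section PoissonPointProcess.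
Variables (R : realType) (dO : measure_display) (Omega : measurableType dO).
Variable P : probability Omega R.
Variables (dT : measure_display) (T : measurableType dT).
(* The random point measure \sum_(i in D a) \delta_(p a i), a \in Omega. *)
Variables (D : Omega -> set nat) (p : Omega -> nat -> T).

Definition point_count (B : set T) (a : Omega) : \bar R :=
  (\esum_(i in D a) \d_(p a i) B)%E.

Definition is_poisson_point_process (mu : set T -> \bar R) :=
  [/\ forall B, measurable B -> measurable_fun setT (point_count B),
      forall B (r : R) (k : nat), measurable B -> mu B = r%:E ->
        P [set a | point_count B a = k%:R%:E] =
        (expR (- r) * r ^+ k / k`!%:R)%:E,
      forall B, measurable B -> mu B = +oo%E ->
        P [set a | point_count B a = +oo%E] = 1%E &
      forall n (B : 'I_n -> set T) (S : 'I_n -> set (\bar R)),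
        (forall i, measurable (B i)) -> (forall i, measurable (S i)) ->
        trivIset setT B ->
        P [set a | forall i, S i (point_count (B i) a)] =
        (\prod_(i < n) P [set a | S i (point_count (B i) a)])%E].

End PoissonPointProcess.

Section RandomInterlacements.
Variables (R : realType) (d : nat) (hd : (3 <= d)%N).
Variable Px : lattice d -> probability (walk_path d) R.
Variables (dO : measure_display) (Omega : measurableType dO).
Variable P : probability Omega R.

Local Notation space := (Wstar hd * measurableTypeR R)%type.

Variables (D : Omega -> set nat) (p : Omega -> nat -> space).

(* The points (w_i*, u_i) of the process, i \in D a, lie in W* x [0, +oo[; the
   second coordinate being typed in R, the intensity is restricted to u >= 0. *)
Definition is_interlacement_process :=
  (forall a i, D a i -> 0 <= (p a i).2) /\
  exists2 nu : {sigma_finite_measure set (Wstar hd) -> \bar R},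
    is_interlacement_measure Px nu &
    is_poisson_point_process P D p
      (fun B : set space => (nu \x lebesgue_measure)%E
         (B `&` (setT `*` [set u | 0 <= u]))).

Definition interlacement (u : R) (a : Omega) : set (lattice d) :=
  \bigcup_(i in [set i | D a i /\ (p a i).2 <= u]) range_star (p a i).1.

Definition cover_level (A : {fset lattice d}) (a : Omega) : \bar R :=
  ereal_inf [set u%:E | u in
    [set u | 0 <= u /\ [set` A] `<=` interlacement u a]].

Definition normalized_cover_level (A : {fset lattice d}) (a : Omega) : \bar R :=
  (cover_level A a / green Px 0 0 - (ln #|` A|%:R)%:E)%E.

End RandomInterlacements.

Definition gumbel_cdf (R : realType) (z : R) : R := expR (- expR (- z)).

(* Convergence in distribution to the law with distribution function F. *)
Definition cvg_in_distribution (R : realType) (dO : measure_display)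
    (Omega : measurableType dO) (P : probability Omega R)
    (X : nat -> Omega -> \bar R) (F : R -> R) :=
  forall z : R, {for z, continuous F} ->
    (fun n => P [set a | (X n a <= z%:E)%E]) @ \oo --> (F z)%:E.

(* Main.v *)
Require Import Defs.
From HB Require Import structures.
From mathcomp Require Import all_boot all_order perm all_algebra finmap.
From mathcomp Require Import all_classical all_reals all_analysis measurable_realfun.
From mathcomp Require Import ring lra zify.
Set Implicit Arguments.
Unset Strict Implicit.
Unset Printing Implicit Defensive.
Import Order.TTheory GRing.Theory Num.Theory.
Import numFieldNormedType.Exports.
Local Open Scope classical_set_scope.
Local Open Scope ring_scope.

(* Write [g] for the Green function, [n] for the cardinality of [A], and take
   the level [u = g(0) (log n + z)], so that each point of [A] is vacant with
   probability [p = e^{-z} / n].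

   The points of [A] are covered almost independently.  Adding the points one
   at a time, let [q] be the probability that the points already treated are
   covered.  Given that a new point [x] is vacant, the interlacement is that of
   the trajectories avoiding [x], whose law is unchanged; so the probability
   that the old points are covered drops from [q], by at most the sum over old
   points [y] of [P(y vacant | x vacant) - p].  Hence
     [(1 - p)^n <= P(A covered) <= (1 - p)^n
         + \sum_{pairs x, y} (P(x, y vacant) - p^2)].
   The last exit decomposition gives [cap{x, y} = 2 / (g(0) + g(x - y))], so
   that [P(x, y vacant) = p^(2 g(0) / (g(0) + g(x - y)))].  Pairs at distance at
   most [n^(c2 / 4 d)] are few and [g(x - y) <= g(0) - 1] bounds their
   contribution; for the other ones [g(x - y)] is polynomially small in [n].
   The decay of [g] (and transience) come from comparison with the
   superharmonic function [(|x|^2 + c)^(- (d - 2) / 4)], [g] being the least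
   nonnegative function [f] with [f - avg f >= 1_0].  This gives the exponent
   [c2 / 32 >= c1] as long as [e^{-z} <= log n]; the other [z] follow by
   monotonicity. *)

(** * Simple random walk: heat kernel, Green function and last exits *)

Section Walk.
Variables (R : realType) (d : nat).
Hypothesis d0 : (0 < d)%N.
Implicit Types (x y z : lattice d) (f h : lattice d -> R).

Definition dir (e : 'I_d * bool) : lattice d := (-1) ^+ e.2 *: delta_mx ord0 e.1.

Definition avg f x : R := (2 * d)%N%:R^-1 * \sum_e f (x + dir e).

(** The transition probability of the walk from [x] to the origin in [n] steps, by conditioning on
    the first step. Accordingly [gfun x] is the Green function [g(x, 0)], once the series is known
    to converge. *)
Fixpoint heat n x : R := if n is m.+1 then avg (heat m) x else (x == 0)%:R.

Definition gpart x : R^nat := series (heat^~ x).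

Definition gfun x : R := limn (gpart x).

Lemma inv2d_gt0 : 0 < (2 * d)%N%:R^-1 :> R.
Proof. by rewrite invr_gt0 ltr0n muln_gt0. Qed.

Lemma card_dir : #|{: 'I_d * bool}| = (2 * d)%N.
Proof. by rewrite card_prod card_ord card_bool mulnC. Qed.

Lemma avg_cst (a : R) x : avg (cst a) x = a.
Proof.
rewrite /avg sumr_const card_dir -[cst a x *+ _]mulr_natr mulrCA mulVf ?mulr1//.
by rewrite lt0r_neq0// -invr_gt0 inv2d_gt0.
Qed.

Lemma avgB f h x : avg (f \- h) x = avg f x - avg h x.
Proof. by rewrite /avg sumrB mulrBr. Qed.

Lemma avgZ a f x : avg (fun y => a * f y) x = a * avg f x.
Proof. by rewrite /avg -mulr_sumr mulrCA. Qed.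

Lemma le_avg f h x : (forall y, f y <= h y) -> avg f x <= avg h x.
Proof.
by move=> fh; rewrite ler_pM2l ?inv2d_gt0//; apply: ler_sum.
Qed.

Lemma eq_avg f h x : f =1 h -> avg f x = avg h x.
Proof. by move=> fh; congr (_ * _); apply: eq_bigr => e _. Qed.

Lemma avg_ge0 f x : (forall y, 0 <= f y) -> 0 <= avg f x.
Proof. by move=> f0; apply: mulr_ge0; [exact: ltW inv2d_gt0 | apply: sumr_ge0 => e _]. Qed.

Lemma heat_ge0 n x : 0 <= heat n x.
Proof. by elim: n x => [|n IH] x /=; [exact: ler0n | exact: avg_ge0]. Qed.

Lemma cvg_avg (f : nat -> lattice d -> R) h x :
  (forall y, f ^~ y @ \oo --> h y) -> (fun n => avg (f n) x) @ \oo --> avg h x.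
Proof.
move=> fh; apply: cvgMl_tmp.
by apply: (cvg_big add_continuous) => e _; exact: fh.
Qed.

Lemma gpartS N x : gpart x N.+1 = (x == 0)%:R + avg (gpart ^~ N) x.
Proof.
rewrite /gpart /series /= big_nat_recl//; congr (_ + _).
under eq_bigr do rewrite /= /avg.
by rewrite -mulr_sumr exchange_big.
Qed.

Lemma nondecreasing_gpart x : nondecreasing_seq (gpart x).
Proof. by apply/nondecreasing_series => n _ _; exact: heat_ge0. Qed.

(** Induction on [N] through the first-step identity [gpartS]. One such [f] therefore gives
    transience, and its decay passes to the Green function. *)
Lemma gpart_le f : (forall x, 0 <= f x) ->
  (forall x, (x == 0)%:R + avg f x <= f x) -> forall N x, gpart x N <= f x.
Proof.
move=> f0 fP; elim=> [|N IH] x; first by rewrite /gpart /series /= big_geq.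
by rewrite gpartS; apply: le_trans (fP x); rewrite lerD2l le_avg.
Qed.

Lemma heat0N n x : heat n (- x) = heat n x.
Proof.
elim: n x => [|n IH] x /=; first by rewrite oppr_eq0.
congr (_ * _).
pose s (e : 'I_d * bool) := (e.1, ~~ e.2).
have sK : involutive s by move=> [i b]; rewrite /s /= negbK.
rewrite (reindex_inj (inv_inj sK)) /=; apply: eq_bigr => e _.
by rewrite -IH opprD opprK; congr (heat n (_ + _)); rewrite /dir /= signrN scaleNr opprK.
Qed.

Lemma avg_shift f x y : avg (fun z => f (z + y)) x = avg f (x + y).
Proof. by congr (_ * _); apply: eq_bigr => e _; rewrite addrAC. Qed.

Definition swap (i j : 'I_d) x : lattice d := col_perm (tperm i j) x.

Lemma swap_dir i j b : swap i j (dir (i, b)) = dir (j, b).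
Proof.
apply/rowP => k; rewrite !mxE /=; congr (_ * _).
by congr (_%:R); rewrite -(inj_eq (@perm_inj _ (tperm i j))) tpermK tpermL.
Qed.

Lemma heat_swap i j n x : heat n (swap i j x) = heat n x.
Proof.
elim: n x => [|n IH] x /=.
  congr (_%:R); congr nat_of_bool; apply/eqP/eqP => [h|->]; last first.
    by apply/rowP => k; rewrite !mxE.
  apply/rowP => k; move/rowP: h => /(_ (tperm i j k)).
  by rewrite !mxE tpermK.
congr (_ * _).
pose s (e : 'I_d * bool) := (tperm i j e.1, e.2).
have sK : involutive s by move=> [k b]; rewrite /s /= tpermK.
rewrite (reindex_inj (inv_inj sK)) /=; apply: eq_bigr => e _.
rewrite -(IH (x + _)); congr (heat n _); apply/rowP => k; rewrite !mxE /=.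
congr (_ + _ * (nat_of_bool _)%:R).
by rewrite -(inj_eq (@perm_inj _ (tperm i j))) tpermK.
Qed.

(** Coordinate swaps and the reflection [x -> - x] preserve the walk and act transitively on the
    neighbours of the origin. *)
Lemma heat_dir n e e' : heat n (dir e) = heat n (dir e').
Proof.
have dirN i b : dir (i, ~~ b) = - dir (i, b) by rewrite /dir /= signrN scaleNr.
case: e e' => [i b] [j b']; rewrite -(heat_swap i j) swap_dir.
have [->//|/negPf] := eqVneq b b'.
by case: b; case: b' => // _; rewrite -heat0N -dirN.
Qed.

(** * Escape probabilities and the decomposition at the last visit *)

Section LastExit.
Variable K : {fset lattice d}.

(** The probability that the walk from [x] avoids [K] at times [1, ..., n]. Time [0] is exempt, so
    that on [K] the limit [escape] is the equilibrium measure. *)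
Fixpoint survival n x : R :=
  if n is m.+1 then avg (fun y => (y \notin K)%:R * survival m y) x else 1.

Definition escape x : R := limn (survival ^~ x).

Lemma survival_ge0 n x : 0 <= survival n x.
Proof. by elim: n x => //= n IH x; apply: avg_ge0 => y; rewrite mulr_ge0. Qed.

Lemma nonincreasing_survival x : nonincreasing_seq (survival ^~ x).
Proof.
apply/nonincreasing_seqP => n; elim: n x => [|n IH] x /=.
  rewrite -[leRHS](avg_cst 1 x); apply: le_avg => y.
  by rewrite mulr1 /=; case: (y \in K); rewrite ?ler01 ?lexx.
by apply: le_avg => y; apply: ler_wpM2l => //; exact: IH.
Qed.

Lemma survival_le1 n x : survival n x <= 1.
Proof. exact: (nonincreasing_survival x (leq0n n)). Qed.

Lemma is_cvg_survival x : cvgn (survival ^~ x).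
Proof.
apply: nonincreasing_is_cvgn; first exact: nonincreasing_survival.
by exists 0 => _ [n _ <-]; exact: survival_ge0.
Qed.

Lemma escape_le n x : escape x <= survival n x.
Proof.
apply: (@nonincreasing_cvgn_ge _ (survival ^~ x)).
  exact: nonincreasing_survival.
exact: is_cvg_survival.
Qed.

Lemma iter_avg_fset n (a : lattice d -> R) x :
  iter n avg (fun y => (y \in K)%:R * a y) x = \sum_(z <- K) heat n (x - z) * a z.
Proof.
elim: n x => [|n IH] x /=.
  have [xK|xK] := boolP (x \in K).
    rewrite mul1r (big_fsetD1 x)//= subrr eqxx mul1r big_seq big1 ?addr0// => z.
    by rewrite in_fsetD1 eq_sym subr_eq0 => /andP[/negPf-> _]; rewrite mul0r.
  rewrite mul0r big_seq big1// => z zK; rewrite subr_eq0.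
  by case: eqP => [xz|_]; [rewrite -xz (negPf xK) in zK|rewrite mul0r].
rewrite (eq_avg _ IH) /avg exchange_big /= mulr_sumr; apply: eq_bigr => z _.
by rewrite -mulr_suml mulrA /avg; under [in RHS]eq_bigr do rewrite addrAC.
Qed.

(* The path visits [K] before time [N] iff it has a last visit there. *)
Lemma last_exit_part N x :
  \sum_(n < N.+1) \sum_(z <- K) heat n (x - z) * survival (N - n) z =
  1 - (x \notin K)%:R * survival N x.
Proof.
under eq_bigr do rewrite -iter_avg_fset.
elim: N x => [|N IH] x.
  by rewrite big_ord1 /= !mulr1; case: (x \in K); rewrite ?subr0 ?subrr.
rewrite big_ord_recl.
transitivity ((x \in K)%:R * survival N.+1 x +
    avg (fun y => \sum_(n < N.+1)
      iter n avg (fun y => (y \in K)%:R * survival (N - n) y) y) x).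
  congr (_ + _); rewrite /avg exchange_big mulr_sumr; apply: eq_bigr => n _.
  by [].
rewrite (eq_avg _ IH) avgB avg_cst -/(survival N.+1 x) /=.
by case: (x \in K) => /=; ring.
Qed.

End LastExit.

Lemma is_cvg_gpart f : (forall x, 0 <= f x) ->
  (forall x, (x == 0)%:R + avg f x <= f x) -> forall x, cvgn (gpart x).
Proof.
move=> f0 fP x; apply: nondecreasing_is_cvgn; first exact: nondecreasing_gpart.
by exists (f x) => _ [N _ <-]; exact: gpart_le.
Qed.

Lemma gfun_le f : (forall x, 0 <= f x) ->
  (forall x, (x == 0)%:R + avg f x <= f x) -> forall x, gfun x <= f x.
Proof.
move=> f0 fP x; apply: limr_le; first exact: is_cvg_gpart f0 fP x.
by near=> N; exact: gpart_le.
Unshelve. all: by end_near. Qed.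

(** * Identities for the Green function under transience *)

Section GreenFunction.
Hypothesis cvg_gpart : forall x, cvgn (gpart x).

Lemma gfunE x : gfun x = (x == 0)%:R + avg gfun x.
Proof.
have : gpart x N.+1 @[N --> \oo] --> gfun x.
  by rewrite (cvg_shiftS (gpart x)); exact: cvg_gpart.
move=> /cvg_lim <- //; apply: cvg_lim => //.
under eq_fun do rewrite gpartS.
by apply: cvgD; [exact: cvg_cst | apply: cvg_avg => y; exact: cvg_gpart].
Qed.

Lemma gpart_le_gfun N x : gpart x N <= gfun x.
Proof. by apply: nondecreasing_cvgn_le; [exact: nondecreasing_gpart|exact: cvg_gpart]. Qed.

Lemma gfun_ge0 x : 0 <= gfun x.
Proof. by apply: le_trans (gpart_le_gfun 0 x); rewrite /gpart /series /= big_geq. Qed.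

Lemma gfunN x : gfun (- x) = gfun x.
Proof. by rewrite /gfun /gpart; congr (limn (series _)); apply/funext => n; exact: heat0N. Qed.

Lemma gfun_dir e e' : gfun (dir e) = gfun (dir e').
Proof. by rewrite /gfun /gpart; congr (limn (series _)); apply/funext => n; exact: heat_dir. Qed.

Lemma gfun_dirE e : gfun (dir e) = gfun 0 - 1.
Proof.
rewrite [gfun 0]gfunE eqxx addrAC subrr add0r /avg.
under eq_bigr do rewrite add0r (gfun_dir _ e).
by have := avg_cst (gfun (dir e)) 0; rewrite /avg => ->.
Qed.

Lemma gfun0_ge1 : 1 <= gfun 0.
Proof. by rewrite gfunE eqxx lerDl avg_ge0// => y; exact: gfun_ge0. Qed.

(* Truncating [gfun] off the origin at its value at the neighbours of the
   origin keeps it superharmonic, and [gfun] is the least such function. *)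
Lemma gfun_le_sub1 x : x != 0 -> gfun x <= gfun 0 - 1.
Proof.
pose f y := if y == 0 then gfun 0 else Num.min (gfun y) (gfun 0 - 1).
have fg y : f y <= gfun y.
  by rewrite /f; case: eqP => [->//|_]; rewrite ge_min lexx.
have f0 y : 0 <= f y.
  rewrite /f; case: eqP => _; first exact: gfun_ge0.
  by rewrite le_min gfun_ge0 subr_ge0 gfun0_ge1.
have fP y : (y == 0)%:R + avg f y <= f y.
  have fgy : (y == 0)%:R + avg f y <= gfun y.
    by rewrite [leRHS]gfunE lerD2l; exact: le_avg.
  rewrite /f; case: eqP => [y0|/eqP y0]; first by move: fgy; rewrite y0 eqxx.
  move: fgy; rewrite (negPf y0) /= => fgy; rewrite le_min fgy /= add0r.
  (* At a neighbour of the origin [gfun] equals [gfun 0 - 1], so the bound is already at hand.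
     Elsewhere off the origin no neighbour of [y] is the origin, so all the averaged values are at
     most [gfun 0 - 1]. *)
  have [[e ye]|nye] := pselect (exists e, y = dir e).
    by move: fgy; rewrite add0r ye gfun_dirE.
  rewrite -[leRHS](avg_cst _ y); rewrite ler_pM2l ?inv2d_gt0//.
  apply: ler_sum => -[i b] _; rewrite /f; case: eqP => [/eqP|_].
    rewrite addrC addr_eq0 => /eqP h; case: nye; exists (i, ~~ b).
    by rewrite /dir /= signrN scaleNr -[RHS]/(- dir (i, b)) h opprK.
  by rewrite ge_min lexx orbT.
move=> x0; apply: le_trans (gfun_le f0 fP x) _.
by rewrite /f (negPf x0) ge_min lexx orbT.
Qed.

(** The limit of [last_exit_part], where the right-hand side is [1] for [x] in [K]. Replacing
    [survival] by the smaller [escape] gives one inequality. *)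
Lemma last_exit (K : {fset lattice d}) x : x \in K ->
  \sum_(z <- K) gfun (x - z) * escape K z = 1.
Proof.
move=> xK.
have E N : \sum_(n < N.+1) \sum_(z <- K) heat n (x - z) * survival K (N - n) z = 1.
  by rewrite last_exit_part xK mul0r subr0.
apply/eqP; rewrite eq_le; apply/andP; split.
  have : \sum_(z <- K) gpart (x - z) N.+1 * escape K z @[N --> \oo] -->
      \sum_(z <- K) gfun (x - z) * escape K z.
    apply: (cvg_big add_continuous) => z _; apply: cvgMr_tmp.
    by rewrite (cvg_shiftS (gpart (x - z))); exact: cvg_gpart.
  move=> /[dup]/cvg_lim <- // /cvgP h; apply: limr_le => //.
  near=> N; rewrite -(E N) exchange_big /=; apply: ler_sum => z _.
  rewrite /gpart /series /= big_mkord mulr_suml; apply: ler_sum => n _.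
  by rewrite ler_wpM2l ?heat_ge0 ?escape_le.
(* For the other inequality take [N = 2 M] and split the visits at time [M]. After an earlier visit
   at least [M] steps remain to survive; the later visits weigh at most the tail of the Green
   series, which vanishes in the limit. *)
have : \sum_(z <- K) (gfun (x - z) * survival K M z + (gfun (x - z) - gpart (x - z) M))
    @[M --> \oo] -->
    \sum_(z <- K) (gfun (x - z) * escape K z + (gfun (x - z) - gfun (x - z))).
  apply: (cvg_big add_continuous) => z _; apply: cvgD.
    by apply: cvgMl_tmp; exact: is_cvg_survival.
  by apply: cvgB; [exact: cvg_cst|exact: cvg_gpart].
under [X in _ --> X]eq_bigr do rewrite subrr addr0.
move=> /[dup]/cvg_lim <- // /cvgP h; apply: limr_ge => //.
near=> M; rewrite -(E (M + M)%N) exchange_big /=; apply: ler_sum => z _.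
rewrite -(big_mkord xpredT (fun n => heat n (x - z) * survival K (M + M - n) z)).
rewrite (@big_cat_nat _ _ _ M)//=; last by lia.
apply: lerD.
  apply: (@le_trans _ _ (gpart (x - z) M * survival K M z)); last first.
    by rewrite ler_wpM2r ?survival_ge0 ?gpart_le_gfun.
  rewrite /gpart /series /= mulr_suml big_nat [leRHS]big_nat; apply: ler_sum => n nM.
  rewrite ler_wpM2l ?heat_ge0//; apply: nonincreasing_survival; lia.
rewrite lerBrDl; apply: le_trans (gpart_le_gfun (M + M).+1 (x - z)).
rewrite /gpart /series /= [leRHS](@big_cat_nat _ _ _ M)//=; last by lia.
rewrite lerD2l; apply: ler_sum => n _.
by rewrite ler_piMr ?heat_ge0 ?survival_le1.
Unshelve. all: by end_near. Qed.

Lemma escape_fset1 x : escape [fset x]%fset x = (gfun 0)^-1.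
Proof.
have := @last_exit [fset x]%fset x; rewrite inE eqxx big_seq_fset1 subrr => /(_ isT) h.
have g0 : gfun 0 != 0 by rewrite gt_eqF// (lt_le_trans ltr01 gfun0_ge1).
by apply: (mulfI g0); rewrite h mulfV.
Qed.

(** Add the last exit equations started at [x] and at [y]: since [gfun] is even, the two escape
    probabilities get the same coefficient. The left-hand side is the capacity of the pair. *)
Lemma escape_fset2 x y : x != y ->
  escape [fset x; y]%fset x + escape [fset x; y]%fset y =
  2 / (gfun 0 + gfun (x - y)).
Proof.
move=> xy.
have := @last_exit [fset x; y]%fset x; have := @last_exit [fset x; y]%fset y.
rewrite !inE !eqxx orbT => /(_ isT) + /(_ isT).
rewrite !big_fsetU1 ?inE// !big_seq_fset1 /= !subrr.
have -> : gfun (y - x) = gfun (x - y) by rewrite -gfunN opprB.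
move=> h1 h2; have g0 : gfun 0 + gfun (x - y) != 0.
  by rewrite gt_eqF// ltr_wpDr ?gfun_ge0// (lt_le_trans ltr01 gfun0_ge1).
by apply: (mulfI g0); rewrite mulrCA mulfV// mulr1; lra.
Qed.

End GreenFunction.
End Walk.

(** * A superharmonic function with polynomial decay *)

Section Lyapunov.
Variable R : realType.

(* The derivative of [y `^ a * (1 - a (y - 1) + b (y - 1)^2)] has the sign of
   [y - 1] near [1]. *)
Lemma powR_taylor2 (a b s : R) : -1 < s -> 0 <= b * (a + 2) ->
  `|s| * (b * (a + 2)) <= 2 * b - a * (a + 1) ->
  1 <= (1 + s) `^ a * (1 - a * s + b * s ^+ 2).
Proof.
move=> s1 B0 hs.
pose f (y : R) := y `^ a * (1 - a * (y - 1) + b * (y - 1) ^+ 2).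
pose df (y : R) := y `^ (a - 1) * ((y - 1) * (2 * b - a * (a + 1) + (y - 1) * (b * (a + 2)))).
have fE : f (1 + s) = (1 + s) `^ a * (1 - a * s + b * s ^+ 2).
  by rewrite /f; have -> : 1 + s - 1 = s by ring.
have f1 : f 1 = 1.
  have p1 : (1 : R) `^ a = 1 by rewrite powR1.
  by rewrite /f p1; ring.
have dfP (y : R) : 0 < y -> is_derive y 1 f (df y).
  move=> y0; rewrite /f.
  have h1 := is_derive1_powR a y0.
  have h2 : is_derive y 1 (fun y : R => 1 - a * (y - 1) + b * (y - 1) ^+ 2)
       (- a + 2 * b * (y - 1)).
    apply: is_derive_eq.
    by rewrite /= /GRing.scale /=; ring.
  apply: is_derive_eq.
  have ya : y `^ a = y `^ (a - 1) * y.
    transitivity (y `^ (a - 1) * y `^ 1); last by rewrite (powRr1 (ltW y0)).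
    by rewrite -powRD ?subrK// (gt_eqF y0) implybT.
  rewrite /GRing.scale /= /df ya.
  by ring.
have mvt (x y : R) : 0 < x -> x < y -> exists2 c, c \in `]x, y[%R & f y - f x = df c * (y - x).
  move=> x0 xy; apply: MVT => //.
    by move=> z; rewrite in_itv /= => /andP[xz _]; apply: dfP; exact: lt_trans xz.
  apply: derivable_within_continuous => z; rewrite in_itv /= => /andP[xz _].
  by have [] := dfP z (lt_le_trans x0 xz).
rewrite -fE -[leLHS]f1 -subr_ge0.
have [s_lt|s_gt|->] := ltgtP s 0; last by rewrite addr0 subrr.
- have [||c] := mvt (1 + s) 1; [lra|lra|].
  rewrite in_itv /= => /andP[c1 c2] h.
  have -> : f (1 + s) - f 1 = df c * s by move: h; lra.
  rewrite /df -mulrA mulr_ge0 ?powR_ge0//.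
  rewrite mulrAC mulr_ge0//; first nra.
  rewrite ltr0_norm// in hs.
  move: (b * (a + 2)) hs B0 => B hs B0.
  have : 0 <= (c - 1 - s) * B by rewrite mulr_ge0//; lra.
  lra.
- have [||c] := mvt 1 (1 + s); [lra|lra|].
  rewrite in_itv /= => /andP[c1 c2] ->.
  rewrite /df -mulrA mulr_ge0 ?powR_ge0//.
  rewrite mulrAC mulr_ge0//; first nra.
  rewrite gtr0_norm// in hs.
  move: (b * (a + 2)) hs B0 => B hs B0.
  have : 0 <= (c - 1) * B by rewrite mulr_ge0//; lra.
  have : 0 <= s * B by rewrite mulr_ge0//; lra.
  lra.
Qed.

Variable d : nat.
Implicit Types x : lattice d.

Definition sqnorm x : R := \sum_i ((x ord0 i)%:~R) ^+ 2.

Lemma sqnorm_ge0 x : 0 <= sqnorm x.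
Proof. by apply: sumr_ge0 => i _; exact: sqr_ge0. Qed.

Lemma sqnorm_ge_coord x i : ((x ord0 i)%:~R) ^+ 2 <= sqnorm x.
Proof.
by rewrite /sqnorm (bigD1 i)//= lerDl sumr_ge0// => j _; exact: sqr_ge0.
Qed.

Lemma sqnorm_dir x i b :
  sqnorm (x + dir (i, b)) = sqnorm x + (1 + 2 * (-1) ^+ b * (x ord0 i)%:~R).
Proof.
rewrite /sqnorm (bigD1 i)//= [in RHS](bigD1 i)//= !mxE !eqxx /= mulr1.
rewrite (eq_bigr (fun j => ((x ord0 j)%:~R : R) ^+ 2)); last first.
  by move=> j /negPf ji; rewrite !mxE ji andbF mulr0 addr0.
by rewrite intrD; case: b; rewrite /= ?expr1 ?expr0 ?mulr1z ?mulrN1z; ring.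
Qed.

Lemma sum_dir (h : 'I_d * bool -> R) :
  \sum_e h e = \sum_i (h (i, false) + h (i, true)).
Proof.
rewrite (eq_bigr (fun e => h (e.1, e.2))); last by case.
rewrite -(pair_bigA _ (fun i b => h (i, b))) /=; apply: eq_bigr => i _.
by rewrite big_bool addrC.
Qed.

Hypothesis d2 : (2 < d)%N.

(** Applied to the squared norm, the exponent [(d - 2) / 2] would give the decay [|x|^(2 - d)]. Half
    of it leaves room for the error terms of a Taylor expansion. *)
Let a : R := (d%:R - 2) / 4.
(** The midpoint between [a (a + 1) / 2], the Taylor coefficient that [b] has to exceed in
    [powR_taylor2], and [a d / 4], below which the averaged second order term stays dominated by the
    first order one. *)
Let b : R := a * (3 * d%:R + 2) / 16.

Let d_ge3 : 3 <= d%:R :> R. Proof. by rewrite (ler_nat _ 3). Qed.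
Let a_gt0 : 0 < a. Proof. by have := d_ge3; rewrite /a; lra. Qed.
Let b_gt0 : 0 < b. Proof. by have := d_ge3; rewrite /b divr_gt0// mulr_gt0//; lra. Qed.

Let s1 : R := Num.min 2^-1 ((2 * b - a * (a + 1)) / (b * (a + 2))).

Let Q_gt0 : 0 < 2 * b - a * (a + 1).
Proof.
have d3 := d_ge3; have -> : 2 * b - a * (a + 1) = a * (d%:R - 2) / 8 by rewrite /b /a; field.
by rewrite divr_gt0// mulr_gt0//; lra.
Qed.

Let B_gt0 : 0 < b * (a + 2).
Proof. by rewrite mulr_gt0// addr_gt0. Qed.

Let s1_gt0 : 0 < s1.
Proof. by rewrite lt_min invr_gt0 ltr0n divr_gt0. Qed.

Let D : R := d%:R * (3 * d%:R + 2) / (4 * (d%:R - 2)).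

Let D_gt0 : 0 < D.
Proof.
by have d3 := d_ge3; apply: divr_gt0; [apply: mulr_gt0; lra | lra].
Qed.

(** The first two terms yield [1 + 2 |X| <= s1 (X^2 + c)] on completing a square, so relative
    increments of the squared norm plus [c] stay within the range [s1] of [powR_taylor2]. The term
    [D] absorbs the lower order terms in [f_superharmonic]. *)
Let c : R := s1^-1 ^+ 2 + s1^-1 + D.

Let c_gt0 : 0 < c.
Proof. by rewrite /c !addr_gt0// ?exprn_gt0 ?invr_gt0. Qed.

Let f x := (sqnorm x + c) `^ (- a).

Let t_gt0 x : 0 < sqnorm x + c.
Proof. by rewrite ltr_wpDl ?sqnorm_ge0. Qed.

(** The step multiplies [sqnorm x + c] by [1 + s], hence [f] by [(1 + s)^(- a)], to which
    [powR_taylor2] applies. *)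
Let f_dir x i e s :
  s = (1 + 2 * (-1) ^+ nat_of_bool e * (x ord0 i)%:~R) / (sqnorm x + c) ->
  f (x + dir (i, e)) <= f x * (1 - a * s + b * s ^+ 2).
Proof.
have d3 := d_ge3; have t0 := t_gt0 x; set X : R := (x ord0 i)%:~R => sE.
have tE : sqnorm (x + dir (i, e)) + c = (sqnorm x + c) * (1 + s).
  have st : (sqnorm x + c) * s = 1 + 2 * (-1) ^+ e * X.
    by rewrite sE mulrC divfK// gt_eqF.
  by rewrite sqnorm_dir mulrDr mulr1 st addrAC.
have sX : `|s| <= s1.
  rewrite sE normrM normfV (gtr0_norm t0) ler_pdivrMr//.
  have h1 : `|1 + 2 * (-1) ^+ e * X| <= 1 + 2 * `|X|.
    apply: le_trans (ler_normD _ _) _; rewrite normr1 lerD2l.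
    by rewrite !normrM normr_sign mulr1 ger0_norm.
  apply: le_trans h1 _.
  have h2 := sqnorm_ge_coord x i.
  rewrite -/X -real_normK ?num_real// in h2.
  have h3 : 1 + 2 * `|X| <= s1 * (`|X| ^+ 2 + (s1^-1 ^+ 2 + s1^-1)).
    have -> : s1 * (`|X| ^+ 2 + (s1^-1 ^+ 2 + s1^-1)) =
        s1 * (`|X| - s1^-1) ^+ 2 + (1 + 2 * `|X|) by field; rewrite gt_eqF.
    by rewrite lerDr mulr_ge0 ?sqr_ge0 ?ltW.
  apply: le_trans h3 _; rewrite ler_pM2l// /c.
  have := D_gt0.
  by lra.
have s_gtN1 : -1 < s.
  have : `|s| <= 2^-1 by apply: le_trans sX _; rewrite ge_min lexx.
  by rewrite ler_norml; lra.
have := powR_taylor2 s_gtN1 (ltW B_gt0).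
have -> : `|s| * (b * (a + 2)) <= 2 * b - a * (a + 1).
  rewrite -ler_pdivlMr//; apply: le_trans sX _.
  by rewrite ge_min lexx orbT.
move=> /(_ isT) h; rewrite /f tE powRM; [|exact: ltW|by lra].
rewrite ler_pM2l ?powR_gt0// powRN.
have p0 : 0 < (1 + s) `^ a by rewrite powR_gt0//; lra.
by rewrite -div1r ler_pdivrMr// mulrC.
Qed.

(** Between opposite directions the terms linear in the coordinates cancel. With [t = sqnorm x + c]
    the sum is [2 d] minus [(2 a d t - 2 b d - 8 b (t - c)) / t^2], whose numerator is nonnegative
    because [t >= c >= D]. *)
Let f_superharmonic x : avg f x <= f x.
Proof.
have d3 := d_ge3; have t0 := t_gt0 x; set t := sqnorm x + c in t0.
pose s i (e : bool) : R := (1 + 2 * (-1) ^+ nat_of_bool e * (x ord0 i)%:~R) / t.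
have -> : f x = (2 * d)%N%:R^-1 * (f x * (2 * d)%N%:R).
  by rewrite mulrCA mulVf ?mulr1// pnatr_eq0; lia.
rewrite ler_pM2l ?invr_gt0 ?ltr0n; last by lia.
apply: (@le_trans _ _ (\sum_(e : 'I_d * bool)
    f x * (1 - a * s e.1 e.2 + b * s e.1 e.2 ^+ 2))).
  by apply: ler_sum => -[i e] _; exact: f_dir erefl.
rewrite -mulr_sumr ler_pM2l ?powR_gt0// sum_dir /=.
under eq_bigr => i _.
  rewrite (_ : _ + _ = 2 - 2 * a / t + 2 * b / t ^+ 2 +
     8 * b / t ^+ 2 * ((x ord0 i)%:~R) ^+ 2); last first.
    by rewrite /s /= expr0 expr1; field; rewrite gt_eqF.
  over.
rewrite big_split /= -mulr_sumr -/(sqnorm x) sumr_const card_ord.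
rewrite -[_ *+ d]mulr_natr natrM.
have -> : sqnorm x = t - c by rewrite /t addrK.
have -> : (2 - 2 * a / t + 2 * b / t ^+ 2) * d%:R + 8 * b / t ^+ 2 * (t - c) =
  2 * d%:R - (2 * a * d%:R * t - 2 * b * d%:R - 8 * b * (t - c)) / t ^+ 2.
  by field; rewrite gt_eqF.
rewrite gerBl divr_ge0 ?sqr_ge0//.
have ct : c <= t by rewrite /t lerDr sqnorm_ge0.
have cd : D <= c.
  by rewrite /c lerDr addr_ge0// ?exprn_ge0// ltW// invr_gt0.
have e1 : 2 * a * d%:R * t - 2 * b * d%:R - 8 * b * (t - c) =
   a * ((d%:R - 2) / 2 * t - d%:R * (3 * d%:R + 2) / 8) + 8 * b * c.
  by rewrite /b; field.
rewrite e1; apply: addr_ge0; last first.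
  exact: mulr_ge0 (mulr_ge0 (ler0n _ 8) (ltW b_gt0)) (ltW c_gt0).
apply: mulr_ge0; [exact: ltW a_gt0|rewrite subr_ge0].
apply: le_trans (_ : (d%:R - 2) / 2 * c <= _); last first.
  by rewrite ler_pM2l//; lra.
rewrite /D ler_pdivrMr in cd; last by lra.
rewrite ler_pdivrMr//; lra.
Qed.

Let f_strict : avg f 0 < f 0.
Proof.
have s0 : sqnorm 0 = 0.
  by rewrite /sqnorm big1// => i _; rewrite mxE expr0n.
rewrite (_ : avg f 0 = (1 + c) `^ (- a)); last first.
  rewrite -[RHS](@avg_cst R d _ _ 0); last by lia.
  congr (_ * _); apply: eq_bigr => -[i e] _.
  by rewrite /f sqnorm_dir s0 mxE mulr0 addr0 add0r.
have c1 : 0 < 1 + c := addr_gt0 ltr01 c_gt0.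
rewrite /f s0 add0r !powRN ltf_pV2 ?posrE ?powR_gt0//.
apply: gt0_ltr_powR; rewrite ?nnegrE ?(ltW c_gt0) ?(ltW c1)//; lra.
Qed.

(** The factor [K] normalizes the strict drop of [f] at the origin to [1]. The decay exponent is
    [2 a], half that of the Green function. *)
Lemma superharmonic_exists : exists2 K : R, 0 < K & exists F : lattice d -> R,
  [/\ forall x, 0 <= F x,
      forall x, (x == 0)%:R + avg F x <= F x &
      forall x i (r : R), 0 < r -> r <= `|(x ord0 i)%:~R| ->
        F x <= K * r `^ (- ((d%:R - 2) / 2))].
Proof.
pose K := (f 0 - avg f 0)^-1.
have K0 : 0 < K by rewrite invr_gt0 subr_gt0.
exists K => //; exists (fun x => K * f x); split=> [x|x|x i r r0 rx].
- by apply: mulr_ge0; [exact: ltW|exact: powR_ge0].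
- rewrite avgZ; have [->|_] := eqVneq x 0; last by rewrite add0r ler_pM2l.
  by rewrite -lerBrDr -mulrBr /K mulVf// gt_eqF// subr_gt0.
- rewrite ler_pM2l//.
  have -> : - ((d%:R - 2) / 2) = 2 * - a by rewrite /a; field.
  rewrite powRrM (powR_mulrn 2) ?(ltW r0)// /f !powRN.
  have h : r ^+ 2 <= sqnorm x + c.
    apply: le_trans (_ : sqnorm x <= _); last by rewrite lerDl ltW.
    apply: le_trans (sqnorm_ge_coord x i); rewrite -[leRHS]real_normK ?num_real//.
    by rewrite lerXn2r ?nnegrE ?(ltW r0).
  rewrite lef_pV2 ?posrE ?powR_gt0 ?exprn_gt0//.
  by apply: ge0_ler_powR; rewrite ?nnegrE ?sqr_ge0 ?(ltW (t_gt0 x)) ?(ltW a_gt0).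
Qed.

End Lyapunov.

Lemma transience (R : realType) (d : nat) (hd : (3 <= d)%N) (x : lattice d) :
  cvgn (gpart R x).
Proof.
have [K _ [F [F0 FP _]]] := superharmonic_exists R hd.
by apply: is_cvg_gpart F0 FP x; exact: leq_trans hd.
Qed.

(** * Events of the walk *)

Section RealProbability.
Context {dT : measure_display} {T : measurableType dT} {R : realType}.
Variable P : probability T R.
Implicit Types A B : set T.

Definition pr A : R := fine (P A).

Lemma prE A : measurable A -> P A = (pr A)%:E.
Proof. by move=> mA; rewrite /pr fineK// fin_num_measure. Qed.

Lemma pr_ge0 A : 0 <= pr A.
Proof. exact: fine_ge0. Qed.

Lemma le_pr A B : measurable A -> measurable B -> A `<=` B -> pr A <= pr B.
Proof. by move=> mA mB AB; rewrite -lee_fin -!prE// le_measure ?inE. Qed.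

Lemma pr_setT : pr setT = 1.
Proof. by rewrite /pr probability_setT. Qed.

Lemma pr_set0 : pr set0 = 0.
Proof. by rewrite /pr measure0. Qed.

Lemma pr_le1 A : measurable A -> pr A <= 1.
Proof. by move=> mA; rewrite -pr_setT; apply: le_pr. Qed.

Lemma pr_setDI A B : measurable A -> measurable B -> pr A = pr (A `\` B) + pr (A `&` B).
Proof.
move=> mA mB; apply: EFin_inj; rewrite EFinD -!prE//; first exact: measureDI.
- exact: measurableI.
- exact: measurableD.
Qed.

Lemma pr_bigcup (I : finType) (F : I -> set T) :
  (forall i, measurable (F i)) -> trivIset setT F -> pr (\bigcup_i F i) = \sum_i pr (F i).
Proof.
move=> mF tF; apply: EFin_inj; rewrite -sumEFin -prE; last first.
  exact: fin_bigcup_measurable.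
rewrite measure_fin_bigcup//; last exact: finite_finset.
have -> : [set: I] = [set` index_enum I].
  by apply/seteqP; split => i // _; rewrite /= mem_index_enum.
rewrite -fsbig_seq ?index_enum_uniq//.
by apply: eq_bigr => i _; exact: prE.
Qed.

End RealProbability.

(** * Finite-dimensional laws of the walk and its escape probabilities *)

Section WalkLaw.
Variables (R : realType) (d : nat).
Hypothesis d0 : (0 < d)%N.
Variable Px : lattice d -> probability (walk_path d) R.
Hypothesis PxP : is_simple_random_walk Px.
Implicit Types (x y z : lattice d) (B : nat -> pred (lattice d)).

Lemma measurable_coord n (B : set (lattice d)) :
  measurable [set X : walk_path d | B (X n)].
Proof.
rewrite (_ : [set X | _] = \bigcup_x (if x \in B then [set X : walk_path d | X n = x] else set0)).
  apply: countable_bigcupT_measurable => [|x]; first exact: countableP.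
  case: ifP => _; last exact: measurable0.
  by apply: sub_sigma_algebra; exists n, x.
apply/seteqP; split => [X /= BX|X [x _]]; first by exists (X n) => //; rewrite mem_set.
by case: ifP => //= /set_mem Bx ->.
Qed.

Lemma nearest_neighbour_dir x e : nearest_neighbour x (x + dir e).
Proof.
case: e => i b; rewrite /nearest_neighbour (bigD1 i)//= !mxE !eqxx /= mulr1.
rewrite opprD addrA subrr add0r normrN normr_sign big1 ?addr0// => j ji.
by rewrite !mxE eqxx (negPf ji) mulr0 addr0 subrr normr0.
Qed.

Lemma dir_inj : injective (@dir d).
Proof.
move=> [i b] [j b'] /rowP h; have := h j; have := h i; rewrite !mxE !eqxx /=.
have [->|ij] := eqVneq i j; first by case: b b' {h} => [] [].
by rewrite mulr1 mulr0; case: b {h}.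
Qed.

(** The probability that the walk from [x] satisfies [B i] at each time [i <= m], by first-step
    recursion. *)
Fixpoint pathprob m B x : R :=
  (B 0%N x)%:R * (if m is m'.+1 then avg (pathprob m' (fun i => B i.+1)) x else 1).

Definition cyl k (xs : nat -> lattice d) : set (walk_path d) :=
  [set X | forall i, (i <= k)%N -> X i = xs i].

Definition in_window k m B : set (walk_path d) :=
  [set X | forall i, (i <= m)%N -> B i (X (k + i)%N)].

Lemma measurable_bounded k (A : nat -> set (walk_path d)) :
  (forall i, measurable (A i)) -> measurable [set X | forall i, (i <= k)%N -> A i X].
Proof.
move=> mA; rewrite (_ : [set X | _] = \bigcap_(i in [set i | (i <= k)%N]) A i).
  by apply: bigcap_measurable => [|i _]//; exists 0%N.
by apply/seteqP; split.
Qed.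

Lemma measurable_cyl k xs : measurable (cyl k xs).
Proof. by apply: measurable_bounded => i; exact: (measurable_coord i [set xs i]). Qed.

Lemma measurable_in_window k m B : measurable (in_window k m B).
Proof. by apply: measurable_bounded => i; exact: (measurable_coord (k + i) (B i)). Qed.

Definition nnpath k (xs : nat -> lattice d) :=
  forall i, (i < k)%N -> exists e, xs i.+1 = xs i + dir e.

Lemma pr_cyl k xs : nnpath k xs -> pr (Px (xs 0%N)) (cyl k xs) = (2 * d)%N%:R^-1 ^+ k.
Proof.
move=> nn; rewrite /pr PxP eqxx mul1r /= (eq_bigr (fun=> (2 * d)%N%:R^-1)).
  by rewrite prodr_const card_ord.
by move=> i _; have [e ->] := nn i (ltn_ord i); rewrite nearest_neighbour_dir.
Qed.

(** The Markov property at time [k], after a prescribed initial path. The induction on [m]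
    prescribes one more step, and the [2 d] possible extensions contribute the average. *)
Lemma pr_window_cyl m k xs B : nnpath k xs ->
  pr (Px (xs 0%N)) (cyl k xs `&` in_window k m B) =
  (2 * d)%N%:R^-1 ^+ k * pathprob m B (xs k).
Proof.
elim: m k xs B => [|m IH] k xs B nn.
  rewrite /= mulr1; have [Bk|Bk] := boolP (B 0%N (xs k)).
    rewrite mulr1 -(pr_cyl nn); congr (pr _ _); apply/seteqP; split => X; first by case.
    move=> cX; split => // i; rewrite leqn0 => /eqP ->.
    by rewrite addn0 cX.
  rewrite mulr0 (_ : _ `&` _ = set0) ?pr_set0// -subset0 => X [cX /(_ 0%N isT)].
  by rewrite addn0 cX// (negPf Bk).
pose xe (e : 'I_d * bool) i := if (i <= k)%N then xs i else xs k + dir e.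
have xe0 e : xe e 0%N = xs 0%N by [].
have xek e : xe e k = xs k by rewrite /xe leqnn.
have xeS e : xe e k.+1 = xs k + dir e by rewrite /xe ltnn.
have nne e : nnpath k.+1 (xe e).
  move=> i; rewrite ltnS leq_eqVlt => /predU1P[->|ik].
    by exists e; rewrite xek xeS.
  by have [e' h] := nn i ik; exists e'; rewrite /xe ik ltnW.
have cylS e X : cyl k.+1 (xe e) X <-> cyl k xs X /\ X k.+1 = xs k + dir e.
  split=> [cX|[cX Xk] i].
    split; last by rewrite cX.
    by move=> i ik; rewrite cX ?(leq_trans ik)// /xe ik.
  by rewrite leq_eqVlt => /predU1P[->|]; rewrite ?xeS// ltnS => ik; rewrite cX// /xe ik.
pose U := \bigcup_e cyl k.+1 (xe e).
have mU : measurable U by apply: fin_bigcup_measurable => // e _; exact: measurable_cyl.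
have tU : trivIset setT (fun e => cyl k.+1 (xe e)).
  move=> e e' _ _ [X [/cylS[_ h] /cylS[_ h']]].
  by apply: dir_inj; apply: (addrI (xs k)); rewrite -h h'.
have d20 : (2 * d)%N%:R != 0 :> R by rewrite pnatr_eq0; lia.
have prU : pr (Px (xs 0%N)) U = pr (Px (xs 0%N)) (cyl k xs).
  rewrite pr_bigcup//; last by move=> e; exact: measurable_cyl.
  rewrite (pr_cyl nn) (eq_bigr (fun=> (2 * d)%N%:R^-1 ^+ k.+1)).
    by rewrite sumr_const card_dir -[LHS]mulr_natr exprSr mulfVK.
  by move=> e _; rewrite -(xe0 e) pr_cyl.
(* The extended cylinders together have the mass of [cyl k xs], so paths leaving [xs k] otherwise
   than by a step [dir e] can be discarded. *)
have null (A : set (walk_path d)) : measurable A ->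
    pr (Px (xs 0%N)) (cyl k xs `&` A) = pr (Px (xs 0%N)) (U `&` A).
  move=> mA; have mC := @measurable_cyl k xs.
  have UC : U `<=` cyl k xs by move=> X [e _ /cylS[]].
  have h0 : pr (Px (xs 0%N)) (cyl k xs `\` U) = 0.
    have := pr_setDI (Px (xs 0%N)) mC mU.
    by rewrite (setIidr UC) prU; lra.
  apply/eqP; rewrite eq_le; apply/andP; split; last first.
    by apply: le_pr; [exact: measurableI|exact: measurableI|exact: setSI].
  rewrite (pr_setDI _ (measurableI _ _ mC mA) mU) -[leRHS]add0r; apply: lerD.
    rewrite -h0; apply: le_pr; [|exact: measurableD|].
      by apply: measurableD => //; exact: measurableI.
    by move=> X [[? ?] ?].
  apply: le_pr; [|exact: measurableI|by move=> X [[? ?] ?]].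
  by apply: measurableI => //; exact: measurableI.
rewrite null; last exact: measurable_in_window.
rewrite setI_bigcupl pr_bigcup; last 2 first.
- by move=> e; apply: measurableI; [exact: measurable_cyl|exact: measurable_in_window].
- by move=> e e' _ _ [X [[h1 _] [h2 _]]]; apply: tU => //; exists X.
rewrite /=; have [Bk|Bk] := boolP (B 0%N (xs k)); last first.
  rewrite mul0r mulr0 big1// => e _.
  rewrite (_ : _ `&` _ = set0) ?pr_set0// -subset0 => X [/cylS[cX _] /(_ 0%N isT)].
  by rewrite addn0 cX// (negPf Bk).
rewrite mul1r /avg mulrA -exprSr mulr_sumr; apply: eq_bigr => e _.
rewrite -xeS -IH// xe0; congr (pr _ _); apply/seteqP; split => X [/cylS[cX Xk] w].
  split; first exact/cylS.
  by move=> i im; rewrite addSnnS; exact: w.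
split; first exact/cylS.
move=> [|i] im; first by rewrite addn0 cX.
by rewrite -addSnnS; exact: w.
Qed.

Lemma pr_window x m B : pr (Px x) (in_window 0 m B) = pathprob m B x.
Proof.
have nn : nnpath 0 (fun=> x) by [].
have := pr_window_cyl m B nn; have := pr_cyl nn; rewrite expr0 mul1r => c1 <-.
have mC := @measurable_cyl 0 (fun=> x); have mW := @measurable_in_window 0 m B.
rewrite (pr_setDI _ mW mC) setIC -[RHS]add0r; congr (_ + _).
apply/eqP; rewrite eq_le pr_ge0 andbT.
have := pr_setDI (Px x) measurableT mC; rewrite setTI c1 pr_setT.
rewrite -[X in X = _]add0r => /addIr ->.
by apply: le_pr; [exact: measurableD|exact: measurableD|exact: setSD].
Qed.

Lemma pr_coord x y n : pr (Px x) [set X : walk_path d | X n = y] = heat R n (x - y).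
Proof.
rewrite (_ : [set X | _] = in_window 0 n (fun i z => (i == n) ==> (z == y))).
  rewrite pr_window; elim: n x => [|n IH] x /=; first by rewrite mulr1 subr_eq0.
  rewrite mul1r -avg_shift; apply: eq_avg => z; rewrite -IH.
  by elim: (n) {IH}.
apply/seteqP; split => X /= => [Xn i _|/(_ n (leqnn n))].
  by rewrite add0n; apply/implyP => /eqP ->; apply/eqP.
by rewrite add0n eqxx => /eqP.
Qed.

Variable K : {fset lattice d}.

Let avoid n : set (walk_path d) :=
  in_window 0 n (fun i z => (0 < i)%N ==> (z \notin K)).

Lemma pr_avoid x n : pr (Px x) (avoid n) = survival R K n x.
Proof.
have aux m z : pathprob m (fun _ z => z \notin K) z = (z \notin K)%:R * survival R K m z.
  by elim: m z => //= m IH z; congr (_ * _); exact: eq_avg.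
rewrite pr_window; case: n => [|n] /=; first by rewrite mulr1.
by rewrite mul1r; apply: eq_avg => z; exact: aux.
Qed.

Lemma never_hitsE : never_hits K = \bigcap_n avoid n.
Proof.
apply/seteqP; split => X /= h => [n _ i _|n n1].
  by rewrite add0n; apply/implyP => i0; exact: h.
by have := h n I n (leqnn n); rewrite add0n n1.
Qed.

Lemma measurable_never_hits : measurable (never_hits K).
Proof.
rewrite never_hitsE; apply: bigcap_measurable => [|n _]; first by exists 0%N.
exact: measurable_in_window.
Qed.

Lemma pr_never_hits x : pr (Px x) (never_hits K) = escape R K x.
Proof.
have : Px x \o avoid @ \oo --> Px x (\bigcap_n avoid n).
  apply: nonincreasing_cvg_mu => [|n||].
  - by have /fin_numPlt/andP[] : Px x (avoid 0) \is a fin_num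
      by rewrite fin_num_measure//; exact: measurable_in_window.
  - exact: measurable_in_window.
  - by rewrite -never_hitsE; exact: measurable_never_hits.
  - apply/nonincreasing_seqP => n; apply/subsetPset => X h i iN.
    by apply: h; exact: leqW.
rewrite -never_hitsE (prE _ measurable_never_hits) => /fine_cvg /cvg_lim h.
rewrite -h//; congr (limn _); apply/funext => n.
by rewrite -pr_avoid.
Qed.

Lemma equilibriumE x : equilibrium Px K x = escape R K x * (x \in K)%:R.
Proof. by rewrite /equilibrium -/(pr _ _) pr_never_hits. Qed.

End WalkLaw.

(** * Void probabilities *)

Section VoidProbabilities.
Context {dO : measure_display} {Omega : measurableType dO} {R : realType}.
Variable P : probability Omega R.
Context {dT : measure_display} {T : measurableType dT}.
Variables (nu : {measure set T -> \bar R}) (V : set T -> set Omega) (u : R).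

Definition fin_meas (E : set T) := measurable E /\ (nu E < +oo)%E.

(** [V E] stands for the event that no trajectory of label at most [u] belongs to [E]; it is later
    instantiated by [vacant]. *)
Hypothesis VU : forall E F, V (E `|` F) = V E `&` V F.
Hypothesis mV : forall E, measurable E -> measurable (V E).
Hypothesis PV : forall E, fin_meas E -> pr P (V E) = expR (- (u * fine (nu E))).

Let VS E F : E `<=` F -> V F `<=` V E.
Proof. by move=> /setUidPr <-; rewrite VU => a []. Qed.

Lemma fin_measU E F : fin_meas E -> fin_meas F -> fin_meas (E `|` F).
Proof.
move=> [mE fE] [mF fF]; split; first exact: measurableU.
by apply: le_lt_trans (measureU2 _ mE mF) _; rewrite lte_add_pinfty.
Qed.

Lemma fin_measD E F : fin_meas E -> fin_meas F -> fin_meas (E `\` F).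
Proof.
move=> [mE fE] [mF fF]; split; first exact: measurableD.
apply: le_lt_trans fE; apply: le_measure; rewrite ?inE//; first exact: measurableD.
Qed.

Lemma pr_voidU E F : fin_meas E -> fin_meas F -> E `&` F = set0 ->
  pr P (V (E `|` F)) = pr P (V E) * pr P (V F).
Proof.
move=> fE fF EF; rewrite !PV//; last exact: fin_measU.
have [[mE nE] [mF nF]] := (fE, fF).
rewrite measureU// fineD ?ge0_fin_numE//.
by rewrite -expRD mulrDr opprD.
Qed.

Variable I : eqType.
Implicit Types (E : I -> set T) (s : seq I).

Definition all_hit E s : set Omega := [set a | forall i, i \in s -> ~ V (E i) a].

Lemma all_hit_cons E i s : all_hit E (i :: s) = all_hit E s `\` V (E i).
Proof.
apply/seteqP; split => [a h|a [h1 h2] j].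
  by split; [move=> j js; apply: h; rewrite inE js orbT|apply: h; rewrite inE eqxx].
by rewrite inE => /predU1P[->//|]; exact: h1.
Qed.

Lemma measurable_all_hit E s : (forall i, fin_meas (E i)) -> measurable (all_hit E s).
Proof.
move=> fE; elim: s => [|i s IH].
  by rewrite (_ : all_hit E [::] = setT)//; apply/seteqP; split.
by rewrite all_hit_cons; apply: measurableD => //; apply: mV; case: (fE i).
Qed.

Lemma pr_all_hit_cons E i s : (forall i, fin_meas (E i)) ->
  pr P (all_hit E (i :: s)) = pr P (all_hit E s) - pr P (V (E i) `&` all_hit E s).
Proof.
move=> fE; have [mEi _] := fE i; have mA := measurable_all_hit s fE.
rewrite all_hit_cons (pr_setDI P mA (mV mEi)).
by rewrite [V _ `&` _]setIC addrK.
Qed.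

(** When [H] is void so is its part [F], and a point of the process in [E j] must then lie outside
    [F]. *)
Lemma void_all_hitD E H F s : F `<=` H ->
  V H `&` all_hit E s = V H `&` all_hit (fun j => E j `\` F) s.
Proof.
move=> FH; apply/seteqP; split => a [VH h]; split => // j js; move: (h j js);
  apply: contra_not => VE.
- have : V (E j `\` F `|` F) a by rewrite VU; split => //; exact: VS FH _ VH.
  by apply: VS => z Ez; have [Fz|Fz] := pselect (F z); [right|left].
- by apply: VS VE => z [].
Qed.

(* Trajectories through [H] are irrelevant to hitting sets disjoint from [H]. *)
Lemma pr_void_all_hit E H s : fin_meas H -> (forall i, fin_meas (E i)) ->
  (forall i, H `&` E i = set0) ->
  pr P (V H `&` all_hit E s) = pr P (V H) * pr P (all_hit E s).
Proof.
elim: s E H => [|i s IH] E H fH fE HE.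
  rewrite (_ : all_hit E [::] = setT); last by apply/seteqP; split.
  by rewrite setIT pr_setT mulr1.
have [mEi _] := fE i; have [mH _] := fH; have mA := measurable_all_hit s fE.
rewrite pr_all_hit_cons// all_hit_cons setIDA.
have := pr_setDI P (measurableI _ _ (mV mH) mA) (mV mEi).
rewrite (IH E H)// => /esym/eqP; rewrite -eq_sym -subr_eq => /eqP <-.
rewrite mulrBr; congr (_ - _).
(* In the part where [E i] is void as well, the void set becomes the union of [H] and [E i].
   Removing [E i] from the other sets restores disjointness, the induction hypothesis applies, and
   [pr_voidU] splits the factor. The removal is then undone with [E i] as the only void set. *)
rewrite setIAC -VU (@void_all_hitD E (H `|` E i) (E i)); last by right.
have fE' j : fin_meas (E j `\` E i) by exact: fin_measD.
rewrite IH//; [|exact: fin_measU|]; last first.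
  move=> j; rewrite -subset0 => z [[Hz|Ez] [Ejz ?//]].
  by rewrite -(HE j).
rewrite pr_voidU// -mulrA (@void_all_hitD E (E i) (E i))// IH//.
by move=> j; rewrite -subset0 => z [Ez [_ /(_ Ez)]].
Qed.

(** A union bound: if all the [E j] are hit but not all the [E' j], then for some [j] the set [E' j]
    is void while [E j] is hit. *)
Lemma pr_all_hit_le E E' s : (forall i, fin_meas (E i)) -> (forall i, fin_meas (E' i)) ->
  (forall i, E' i `<=` E i) ->
  0 <= pr P (all_hit E s) - pr P (all_hit E' s) <=
  \sum_(j <- s) (pr P (V (E' j)) - pr P (V (E j))).
Proof.
move=> fE fE' EE'; have mA t := measurable_all_hit t fE; have mA' t := measurable_all_hit t fE'.
have sub t : all_hit E' t `<=` all_hit E t.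
  by move=> a h j jt; apply: contra_not (h j jt); exact: VS (EE' j) a.
rewrite subr_ge0 le_pr//=.
elim: s => [|i s IH].
  rewrite big_nil (_ : all_hit E [::] = setT); last by apply/seteqP; split.
  by rewrite (_ : all_hit E' [::] = setT) ?subrr//; apply/seteqP; split.
have [mEi _] := fE i; have [mEi' _] := fE' i.
have mVi := mV mEi; have mVi' := mV mEi'.
rewrite big_cons.
have h1 := pr_setDI P (mA s) (mA' s); rewrite (setIidr (sub s)) in h1.
have h2 := pr_setDI P mVi' mVi; rewrite (setIidr (VS (EE' i))) in h2.
have h3 := pr_setDI P (mA (i :: s)) (mA' (i :: s)).
rewrite (setIidr (sub (i :: s))) in h3.
suff : pr P (all_hit E (i :: s) `\` all_hit E' (i :: s)) <=
    pr P (V (E' i) `\` V (E i)) + pr P (all_hit E s `\` all_hit E' s) by lra.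
have mB1 := measurableD mVi' mVi; have mB2 := measurableD (mA s) (mA' s).
apply: (@le_trans _ _ (pr P ((V (E' i) `\` V (E i)) `|` (all_hit E s `\` all_hit E' s)))).
  apply: le_pr; [exact: measurableD|exact: measurableU|].
  rewrite !all_hit_cons => a [[h4 h5] h6].
  have [h7|h7] := pselect (all_hit E' s a); last by right.
  by left; split=> //; apply: contrapT => h8; apply: h6.
rewrite -lee_fin EFinD -!prE//; last exact: measurableU.
exact: measureU2.
Qed.

(* With [p] the common void probability, a one-step recursion: conditionally on
   [E i] being void, the trajectories outside [E i] keep their law. *)
Lemma pr_all_hit_bounds E (p b : R) N :
  (forall i, fin_meas (E i)) -> (forall i, pr P (V (E i)) = p) ->
  (forall i s, uniq (i :: s) -> (size s <= N)%N ->
     \sum_(j <- s) (pr P (V (E i `|` E j)) - p ^+ 2) <= b) ->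
  forall s, uniq s -> (size s <= N)%N ->
  (1 - p) ^+ size s <= pr P (all_hit E s) <= (1 - p) ^+ size s + (size s)%:R * b.
Proof.
move=> fE pE bE; elim=> [|i s IH] us sN.
  rewrite (_ : all_hit E [::] = setT); last by apply/seteqP; split.
  by rewrite pr_setT expr0 mul0r addr0 lexx.
have sN' : (size s <= N)%N by exact: ltnW.
have /andP[lo up] := IH (andP us).2 sN'.
have fE' j : fin_meas (E j `\` E i) by exact: fin_measD.
have p01 : 0 <= p <= 1.
  by rewrite -(pE i) pr_ge0 pr_le1//; apply: mV; case: (fE i).
have disj j : E i `&` (E j `\` E i) = set0.
  by rewrite -subset0 => z [Ez [_ /(_ Ez)]].
have /andP[d0 d1] := @pr_all_hit_le E _ s fE fE' (fun j => @subDsetl _ _ _).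
rewrite pr_all_hit_cons// (@void_all_hitD E (E i) (E i))// pr_void_all_hit// pE.
set q := pr P (all_hit E s) in lo up d0 d1 *.
set q' := pr P _ in d0 d1 *.
(* The new probability is [q - p q' = (1 - p) q + p (q - q')]. Multiplying by [p], the void
   probability of [E i], turns that of [E j] minus [E i] into the joint one, which the assumption on
   pairs controls. *)
have h : p * (q - q') <= b.
  apply: le_trans (bE i s us sN').
  apply: le_trans (ler_wpM2l (andP p01).1 d1) _.
  rewrite mulr_sumr; apply: ler_sum => j _.
  rewrite mulrBr pE -expr2 lerD2r -(pE i) -pr_voidU//.
  by rewrite setDE setUIr setUv setIT lexx.
have h' : 0 <= p * (q - q') by rewrite mulr_ge0//; case/andP: p01.
rewrite /= exprS -natr1.
have p1 : 0 <= 1 - p by lra.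
have := ler_wpM2l p1 lo; have := ler_wpM2l p1 up.
have sb : 0 <= (size s)%:R * b * p.
  by rewrite !mulr_ge0//; [exact: le_trans h|lra].
move=> A1 A2; apply/andP; split; lra.
Qed.

End VoidProbabilities.

(** * Capacities and the interlacement process *)

Section Green.
Variables (R : realType) (d : nat) (hd : (3 <= d)%N).
Variable Px : lattice d -> probability (walk_path d) R.
Hypothesis PxP : is_simple_random_walk Px.

Let d0 : (0 < d)%N. Proof. exact: leq_trans hd. Qed.

Lemma greenE x y : green Px x y = (gfun R (x - y))%:E.
Proof.
rewrite /green /gfun -EFin_lim; last exact: transience hd _.
congr (limn _); apply/funext => N.
rewrite /gpart /series /= -sumEFin; apply: eq_bigr => n _.
rewrite -(pr_coord d0 PxP) prE//.
exact: (measurable_coord n [set y]).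
Qed.

Lemma c2E : c2 Px = (gfun R (0 : lattice d))^-1.
Proof.
by rewrite /c2 -/(pr _ _) (pr_never_hits d0 PxP) (escape_fset1 d0 (@transience R d hd)).
Qed.

End Green.

Section Trajectories.
Variables (d : nat) (hd : (3 <= d)%N).
Local Notation W := (trajectory hd).

Lemma range_star_pi (w : W) : range_star (pi_star w) = range (sval w).
Proof.
apply/seteqP; split => [x [v /= vw [n _ <-]]|x xw]; last by exists w.
have /eqmodP/asboolP[N h] : (v = w %[mod Wstar hd])%qT by exact: vw.
by exists (n + N) => //; rewrite h.
Qed.

Lemma measurable_W_coord (n : int) x : measurable [set w : W | sval w n = x].
Proof. by apply: sub_sigma_algebra; exists n, x. Qed.

Lemma measurable_entering (K : {fset lattice d}) : measurable (@entering _ hd K).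
Proof.
rewrite /measurable /= /Wstar_measurable /image_set_system /= setTI.
rewrite (_ : _ @^-1` _ = \bigcup_(x in [set` K]) \bigcup_n [set w : W | sval w n = x]).
  apply: fin_bigcup_measurable; first exact: finite_fset.
  move=> x _; apply: countable_bigcupT_measurable => [|n]; first exact: countableP.
  exact: measurable_W_coord.
apply/seteqP; split => [w [x xK]|w [x xK [n _ wn]]].
  by rewrite range_star_pi => -[n _ wn]; exists x => //; exists n.
by exists x => //; rewrite range_star_pi; exists n.
Qed.

Lemma enteringU (K L : {fset lattice d}) :
  @entering _ hd (K `|` L)%fset = @entering _ hd K `|` @entering _ hd L.
Proof.
apply/seteqP; split => w.
  by move=> [x]; rewrite inE => /orP[] xK wx; [left|right]; exists x.
by move=> [] [x xK wx]; exists x => //; rewrite inE xK ?orbT.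
Qed.

Variables (R : realType) (Px : lattice d -> probability (walk_path d) R).

(** The total mass is the capacity of [K]: decompose according to the position at time [0], which
    lies in [K] almost everywhere. *)
Lemma is_Q_setT (K : {fset lattice d}) (Q : {finite_measure set W -> \bar R}) :
  is_Q Px K Q -> Q setT = (\sum_(x <- K) equilibrium Px K x)%:E.
Proof.
move=> QP; pose at0 x := [set w : W | sval w 0 = x].
have Qx x : Q (at0 x) = (equilibrium Px K x)%:E.
  have := QP setT setT x measurableT measurableT.
  rewrite setTI probability_setT mulr1 (_ : [set w : W | _] = at0 x); last first.
    by apply/seteqP; split => [w [] //|w]; split.
  move=> ->; rewrite /equilibrium; congr EFin.
  (* With zero escape probability the quotient is [0 / 0 = 0], and the equilibrium measure vanishes
     too. *)
  have [->|e0] := eqVneq (fine (Px x (never_hits K))) 0; first by rewrite !mul0r.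
  by rewrite mulfV// mul1r.
have m0 x : measurable (at0 x) by exact: measurable_W_coord.
have null : Q [set w : W | sval w 0 \notin K] = 0%E.
  (* Enumerating the lattice makes the event a countable union of null sets, one for each position
     outside [K]. *)
  pose G n : set W := if choice.unpickle n is Some x then
    (if x \in K then set0 else at0 x) else set0.
  have mG n : measurable (G n).
    by rewrite /G; case: (choice.unpickle n : option (lattice d)) => [x|]//; case: ifP.
  rewrite (_ : [set w | _] = \bigcup_n G n).
    apply: measure_negligible; first exact: bigcup_measurable.
    apply: negligible_bigcup => n; apply/negligibleP => //.
    rewrite /G; case: (choice.unpickle n : option (lattice d)) => [x|]; last exact: measure0.
    case: ifPn => [_|xK]; first exact: measure0.
    by have := Qx x; rewrite /equilibrium (negPf xK) mulr0.
  apply/seteqP; split => [w /= wK|w [n _]].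
    by exists (choice.pickle (sval w 0)) => //; rewrite /G choice.pickleK (negPf wK).
  rewrite /G; case: (choice.unpickle n : option (lattice d)) => [x|//].
  by case: ifPn => // xK /= ->.
have mnull : measurable [set w : W | sval w 0 \notin K].
  rewrite (_ : [set w | _] = ~` \bigcup_(x in [set` K]) at0 x).
    by apply: measurableC; apply: fin_bigcup_measurable.
  apply/seteqP; split => [w /= /negP wK [x xK /= wx]|w /= wK].
    by apply: wK; rewrite wx.
  by apply/negP => wK'; apply: wK; exists (sval w 0).
rewrite (_ : setT = \bigcup_(x in [set` K]) at0 x `|` [set w : W | sval w 0 \notin K]).
  rewrite measureU//; last 2 first.
  - exact: fin_bigcup_measurable.
  - by rewrite -subset0 => w [[x xK /= wx]]; rewrite /= wx xK.
  rewrite [X in (_ + X)%E]null adde0 measure_fin_bigcup//.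
    by rewrite -fsbig_seq// -sumEFin; apply: eq_bigr => x _; exact: Qx.
  by move=> x y _ _ [w [/= wx wy]]; rewrite -wx -wy.
apply/seteqP; split => // w _ /=.
by have [wK|wK] := boolP (sval w 0 \in K); [left; exists (sval w 0)|right].
Qed.

Lemma entering_mass (K : {fset lattice d}) (nu : set (Wstar hd) -> \bar R) :
  is_interlacement_measure Px nu ->
  nu (@entering _ hd K) = (\sum_(x <- K) equilibrium Px K x)%:E.
Proof.
move=> /(_ K)[Q QP nuQ].
by rewrite -[@entering _ hd K]setTI nuQ// /pushforward preimage_setT (is_Q_setT QP).
Qed.

End Trajectories.

Section Interlacement.
Variables (R : realType) (d : nat) (hd : (3 <= d)%N).
Variable Px : lattice d -> probability (walk_path d) R.
Hypothesis PxP : is_simple_random_walk Px.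
Context {dO : measure_display} {Omega : measurableType dO}.
Variable P : probability Omega R.
Local Notation space := (Wstar hd * measurableTypeR R)%type.
Variables (D : Omega -> set nat) (p : Omega -> nat -> space).
Variable nu : {sigma_finite_measure set (Wstar hd) -> \bar R}.
Hypothesis nuP : is_interlacement_measure Px nu.
Hypothesis PPP : is_poisson_point_process P D p
  (fun B : set space => (nu \x lebesgue_measure)%E (B `&` (setT `*` [set u | 0 <= u]))).

Definition vacant u (E : set (Wstar hd)) : set Omega :=
  [set a | forall i, D a i -> (p a i).2 <= u -> ~ E (p a i).1].

Lemma vacantE u E : vacant u E =
  [set a | point_count R D p (E `*` [set v | v <= u]) a = 0%:R%:E].
Proof.
apply/seteqP; split => [a h|a /= h i Di iu Ei].
  apply: esum1 => i Di; rewrite diracE memNset// => -[Ei iu].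
  exact: (h i Di iu).
have : (1 <= 0%:R%:E :> \bar R)%E.
  rewrite -h; apply: esum_ge; exists [set i].
    by split => // j ->.
  by rewrite fsbig_set1 diracE mem_set.
by rewrite lee_fin ler10.
Qed.

Lemma measurable_le_set (u : R) : measurable [set v : measurableTypeR R | v <= u].
Proof.
by rewrite (_ : [set v | _] = `]-oo, u]%classic)//; apply/seteqP; split => v /=; rewrite in_itv.
Qed.

Lemma measurable_vacant u E : measurable E -> measurable (vacant u E).
Proof.
move=> mE; rewrite vacantE; have [mc _ _ _] := PPP.
rewrite -[X in measurable X]setTI.
apply: (mc (E `*` [set v | v <= u]) _ measurableT [set 0%:R%:E]).
  by apply: measurableX => //; exact: measurable_le_set.
exact: emeasurable_set1.
Qed.

(** The Poisson weight at [k = 0]. Restricting to nonnegative labels turns the half-line up to [u]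
    into [[0, u]], so the intensity is [u] times the mass of [E]. *)
Lemma pr_vacant u E : 0 <= u -> fin_meas nu E ->
  pr P (vacant u E) = expR (- (u * fine (nu E))).
Proof.
move=> u0 [mE fE]; have [_ pk _ _] := PPP.
have mB : measurable (E `*` [set v : measurableTypeR R | v <= u]).
  by apply: measurableX => //; exact: measurable_le_set.
rewrite /pr vacantE (pk _ (u * fine (nu E)) 0%N mB) ?expr0 ?fact0 ?mulr1 ?divr1//.
rewrite -setXI setIT.
rewrite (_ : _ `&` _ = `[0, u]%classic); last first.
  apply/seteqP; split => v /=; rewrite in_itv /=.
    by move=> [? ?]; apply/andP.
  by move=> /andP[].
rewrite product_measure1E//.
have L : lebesgue_measure (`[0, u]%classic : set R) = u%:E.
  rewrite lebesgue_measure_itv /= lte_fin.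
  case: ltP => [_|u0']; first by rewrite sube0.
  by congr EFin; apply: le_anti; rewrite u0' u0.
transitivity (nu E * u%:E)%E; first by congr (_ * _)%E; exact: L.
have -> : nu E = (fine (nu E))%:E by rewrite fineK// ge0_fin_numE.
by rewrite -EFinM mulrC.
Qed.

Let d0 : (0 < d)%N. Proof. exact: leq_trans hd. Qed.

Lemma nu_entering1 x : nu (@entering _ hd [fset x]%fset) = ((gfun R (0 : lattice d))^-1)%:E.
Proof.
rewrite (entering_mass _ nuP) big_seq_fset1 (equilibriumE d0 PxP) inE eqxx mulr1.
by rewrite (escape_fset1 d0 (@transience R d hd)).
Qed.

Lemma nu_entering2 x y : x != y ->
  nu (@entering _ hd [fset x]%fset `|` @entering _ hd [fset y]%fset) =
  (2 / (gfun R (0 : lattice d) + gfun R (x - y)))%:E.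
Proof.
move=> xy; rewrite -enteringU (entering_mass _ nuP) big_fsetU1 ?inE// big_seq_fset1.
rewrite !(equilibriumE d0 PxP) !inE !eqxx orbT !mulr1.
by rewrite /= (escape_fset2 d0 (@transience R d hd) xy).
Qed.

Lemma fin_meas_entering x : fin_meas nu (@entering _ hd [fset x]%fset).
Proof.
split; first exact: measurable_entering.
by have := ltry (gfun R (0 : lattice d))^-1; rewrite -(nu_entering1 x).
Qed.

Lemma vacant_setU u E F : vacant u (E `|` F) = vacant u E `&` vacant u F.
Proof.
apply/seteqP; split => [a h|a [h1 h2] i Di iu [?|?]].
- by split => i Di iu Ei; apply: (h i Di iu); [left|right].
- exact: (h1 i).
- exact: (h2 i).
Qed.

Lemma covered_all_hit u (A : {fset lattice d}) :
  [set a | [set` A] `<=` interlacement D p u a] =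
  all_hit (vacant u) (fun x => @entering _ hd [fset x]%fset) A.
Proof.
apply/seteqP; split => a h x xA.
  have [i [Di iu] ix] := h x xA; move=> /(_ i Di iu); apply.
  by exists x; rewrite ?inE.
apply: contrapT => nx; apply: (h x xA) => i Di iu [y]; rewrite inE => /eqP -> ix.
by apply: nx; exists i.
Qed.

End Interlacement.

(** * Sums over pairs *)

Section PairSum.
Variable d : nat.
Implicit Types (x y : lattice d) (s : seq (lattice d)).

Definition in_box m x : bool := [forall i, (`|x ord0 i| <= m)%N].

(** Shifting the coordinates of [x - y] by [m] sends the points counted injectively into
    [{0, ..., 2 m}^d]. *)
Lemma box_count m x s : uniq s ->
  (count (fun y => in_box m (x - y)) s <= (2 * m + 1) ^ d)%N.
Proof.
move=> us; rewrite -size_filter; set t := (X in size X).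
pose h y : {ffun 'I_d -> 'I_(2 * m).+1} :=
  [ffun i => inord (absz ((x - y) ord0 i + m%:Z))].
have ht : uniq (map h t).
  rewrite map_inj_in_uniq ?filter_uniq// => y z.
  rewrite !mem_filter => /andP[/forallP yb _] /andP[/forallP zb _] /ffunP yz.
  apply/rowP => i; have := yz i; rewrite !ffunE => /(congr1 val) /=.
  have := yb i; have := zb i; rewrite !mxE !ord1 => hz hy.
  move: (x 0 i) (y 0 i) (z 0 i) hy hz => a b c hy hz.
  by rewrite !inordK; lia.
rewrite -(size_map h) -(card_uniqP ht).
by apply: leq_trans (max_card _) _; rewrite card_ffun !card_ord addn1.
Qed.

End PairSum.

(** * Joint vacancy of two points compared with independence *)

Section PairTerm.
Variable R : realType.

(** Here [v * g0] is the level and [2 / (g0 + e)] the capacity of a pair whose Green function is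
    [e]. Since [e <= g0 - 1], their product is at least [v * 2 g0 / (2 g0 - 1)]. *)
Lemma pair_term_near (g0 e v : R) : 1 <= g0 -> 0 <= e -> 0 <= v -> e <= g0 - 1 ->
  expR (- (v * g0 * (2 / (g0 + e)))) <= expR (- (1 + g0^-1 / 2) * v).
Proof.
move=> g01 e0 v0 eg; have h : 1 + g0^-1 / 2 <= g0 * (2 / (g0 + e)).
  rewrite mulrA ler_pdivlMr; last by lra.
  have -> : (1 + g0^-1 / 2) * (g0 + e) = (2 * g0 + 1) * (g0 + e) / (2 * g0).
    by field; rewrite gt_eqF//; lra.
  by rewrite ler_pdivrMr; [nra|lra].
by rewrite ler_expR mulNr lerN2 -mulrA [leLHS]mulrC ler_wpM2l.
Qed.

(** With [t = 2 e / (g0 + e) <= th] the difference is [e^{-2v} (e^{tv} - 1)]. Then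
    [e^{tv} - 1 <= t v e^{tv}], and the factor [v] is paid for by [v <= e^{sv} / s]. *)
Lemma pair_term_far (g0 e v th s : R) :
  1 <= g0 -> 0 <= e -> 0 <= v -> 0 < s -> 2 * e <= th -> th <= s ->
  expR (- (v * g0 * (2 / (g0 + e)))) - expR (- v) ^+ 2 <=
  th / s * expR (- (2 - 2 * s) * v).
Proof.
move=> g01 e0 v0 s0 eth ths; pose t := 2 * e / (g0 + e).
have ge : 0 < g0 + e by lra.
have t0 : 0 <= t by rewrite divr_ge0//; lra.
have tth : t <= th by rewrite ler_pdivrMr//; nra.
have -> : - (v * g0 * (2 / (g0 + e))) = - (v *+ 2) + t * v.
  by rewrite /t mulr2n; field; rewrite gt_eqF.
have -> : expR (- v) ^+ 2 = expR (- (v *+ 2)).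
  by rewrite -mulNrn -mulr_natl expRM_natl.
rewrite expRD.
have -> : - (2 - 2 * s) * v = - (v *+ 2) + (s * v + s * v) by rewrite mulr2n; ring.
rewrite (expRD (- (v *+ 2))) mulrCA -[X in _ - X]mulr1 -mulrBr ler_pM2l ?expR_gt0//.
have h1 : expR (t * v) - 1 <= t * v * expR (t * v).
  have := expR_ge1Dx (- (t * v)); rewrite expRN.
  have := expR_gt0 (t * v); move: (expR (t * v)) => E E0 h.
  have : (1 - t * v) * E <= 1 by rewrite -ler_pdivlMr// mul1r.
  by lra.
apply: le_trans h1 _; rewrite expRD mulrA; apply: ler_pM.
- by rewrite mulr_ge0.
- exact: expR_ge0.
- have vs : v <= s^-1 * expR (s * v).
    by rewrite ler_pdivlMl//; apply: le_trans (expR_ge1Dx _); lra.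
  by rewrite -[leRHS]mulrA; exact: ler_pM.
- by rewrite ler_expR ler_wpM2r//; lra.
Qed.

End PairTerm.

(** * Bounds on the probability of being covered at a given level *)

Section CoveredBounds.
Variables (R : realType) (d : nat) (hd : (3 <= d)%N).
Local Notation g0 := (gfun R (0 : lattice d)).

Let d0 : (0 < d)%N. Proof. exact: leq_trans hd. Qed.

(** Off the box some coordinate is at least [m.+1] in absolute value. The factor [2] is the one in
    [2 * e <= th] of [pair_term_far]. *)
Definition decay (K : R) (m : nat) : R := 2 * (K * m.+1%:R `^ (- ((d%:R - 2) / 2))).

Definition pair_bound (K s : R) (m n : nat) (v : R) : R :=
  ((2 * m + 1) ^ d)%:R * expR (- (1 + g0^-1 / 2) * v) +
  n%:R * (decay K m / s * expR (- (2 - 2 * s) * v)).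

Definition gfun_decay (K : R) := forall (x : lattice d) m, ~~ in_box m x ->
  2 * gfun R x <= decay K m.

Lemma gfun_decay_exists : exists2 K, 0 < K & gfun_decay K.
Proof.
have [K K0 [F [F0 FP FK]]] := superharmonic_exists R hd.
exists K => // x m /forallPn[i]; rewrite -ltnNge => xm.
rewrite /decay ler_pM2l//; apply: le_trans (gfun_le d0 F0 FP x) _.
apply: FK (i) _ _ _; first by rewrite ltr0n.
by rewrite -intr_norm -abszE -pmulrn ler_nat.
Qed.

Lemma pair_sum_le K s m n x (l : seq (lattice d)) v : 0 < K -> gfun_decay K ->
  0 <= v -> 0 < s -> decay K m <= s -> uniq (x :: l) -> (size l <= n)%N ->
  \sum_(y <- l) (expR (- (v * g0 * (2 / (g0 + gfun R (x - y))))) - expR (- v) ^+ 2)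
  <= pair_bound K s m n v.
Proof.
move=> K0 Kg v0 s0 Ks /andP[xl ul] ln.
have tr := @transience R d hd; have g1 : 1 <= g0 := gfun0_ge1 d0 tr.
set A := expR (- (1 + g0^-1 / 2) * v).
set B := decay K m / s * expR (- (2 - 2 * s) * v).
have dK0 : 0 <= decay K m.
  by rewrite mulr_ge0// mulr_ge0 ?powR_ge0// ltW.
have B0 : 0 <= B by rewrite mulr_ge0 ?expR_ge0// divr_ge0// ltW.
have term y : y \in l ->
    expR (- (v * g0 * (2 / (g0 + gfun R (x - y))))) - expR (- v) ^+ 2 <=
    (in_box m (x - y))%:R * A + B.
  move=> yl; have xy : x - y != 0.
    by rewrite subr_eq0; apply: contraNneq xl => ->.
  have e0 := gfun_ge0 d0 tr (x - y); have e1 := gfun_le_sub1 d0 tr xy.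
  have [b|b] := boolP (in_box m (x - y)).
    rewrite mul1r -[leLHS]addr0; apply: lerD; last exact: B0.
    have := pair_term_near g1 e0 v0 e1; have := sqr_ge0 (expR (- v)); rewrite -/A.
    lra.
  by rewrite mul0r add0r; apply: pair_term_far => //; exact: Kg.
apply: (@le_trans _ _ (\sum_(y <- l) ((in_box m (x - y))%:R * A + B))).
  by rewrite big_seq [leRHS]big_seq; apply: ler_sum.
rewrite big_split /= -mulr_suml; apply: lerD.
  rewrite ler_wpM2r ?expR_ge0//.
  rewrite -natr_sum ler_nat; apply: leq_trans _ (box_count m x ul).
  by rewrite -sum1_count [leqRHS]big_mkcond /=; apply: leq_sum => y _; case: in_box.
rewrite big_const_seq count_predT iter_addr_0 -[leLHS]mulr_natl -/B.
by rewrite ler_wpM2r// ler_nat.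
Qed.

Variable Px : lattice d -> probability (walk_path d) R.
Hypothesis PxP : is_simple_random_walk Px.
Context {dO : measure_display} {Omega : measurableType dO}.
Variable P : probability Omega R.
Local Notation space := (Wstar hd * measurableTypeR R)%type.
Variables (D : Omega -> set nat) (p : Omega -> nat -> space).
Hypothesis Dp : is_interlacement_process Px P D p.

Definition covered (A : {fset lattice d}) u : set Omega :=
  [set a | [set` A] `<=` interlacement D p u a].

Lemma measurable_covered A u : measurable (covered A u).
Proof.
have [_ [nu nuP PPP]] := Dp; rewrite /covered covered_all_hit.
have mV E : measurable E -> measurable (vacant D p u E) by exact: (measurable_vacant PPP).
by apply: (measurable_all_hit mV) => x; exact: (fin_meas_entering PxP nuP).
Qed.

Lemma pr_covered_bounds (A : {fset lattice d}) K s m v : 0 < K -> gfun_decay K ->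
  0 <= v -> 0 < s -> decay K m <= s ->
  (1 - expR (- v)) ^+ #|` A| <= pr P (covered A (v * g0)) <=
  (1 - expR (- v)) ^+ #|` A| + #|` A|%:R * pair_bound K s m #|` A| v.
Proof.
move=> K0 Kg v0 s0 Ks; have [_ [nu nuP PPP]] := Dp; rewrite /covered covered_all_hit.
have tr := @transience R d hd; have g1 : 1 <= g0 := gfun0_ge1 d0 tr.
have u0 : 0 <= v * g0 by rewrite mulr_ge0//; lra.
pose E x := @entering _ hd [fset x]%fset.
have fE x : fin_meas nu (E x) := fin_meas_entering PxP nuP x.
have PV := pr_vacant PPP u0.
have VE x : pr P (vacant D p (v * g0) (E x)) = expR (- v).
  rewrite PV// (nu_entering1 PxP nuP) /= mulfK// gt_eqF//; lra.
have mV F' : measurable F' -> measurable (vacant D p (v * g0) F').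
  exact: (measurable_vacant PPP).
apply: (pr_all_hit_bounds (N := #|` A|) (vacant_setU D p (v * g0)) mV PV fE VE) => //.
  move=> x l xl ln; apply: le_trans (pair_sum_le K0 Kg v0 s0 Ks xl ln).
  rewrite big_seq [leRHS]big_seq; apply: ler_sum => y yl.
  rewrite lerD2r PV; last exact: fin_measU.
  rewrite (nu_entering2 PxP nuP)//.
  by case/andP: xl => xl _; apply: contraNneq xl => ->.
Qed.

End CoveredBounds.

(** * The error term *)

Section ErrorTerm.
Variables (R : realType) (d : nat) (hd : (3 <= d)%N).
Local Notation g0 := (gfun R (0 : lattice d)).

Lemma powB_le (a b : R) n : 0 <= b -> b <= a -> a <= 1 -> a ^+ n - b ^+ n <= n%:R * (a - b).
Proof.
move=> b0 ba a1; elim: n => [|n IH]; first by rewrite !expr0 subrr mul0r.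
have an : a ^+ n <= 1 by rewrite exprn_ile1//; lra.
have bn : 0 <= b ^+ n by rewrite exprn_ge0.
have -> : a ^+ n.+1 - b ^+ n.+1 = b * (a ^+ n - b ^+ n) + a ^+ n * (a - b).
  by rewrite !exprS; ring.
rewrite -natr1 mulrDl mul1r; apply: lerD.
  apply: le_trans IH; rewrite ler_piMl//; last lra.
  by rewrite subr_ge0 lerXn2r ?nnegrE//; lra.
by rewrite ler_piMl//; lra.
Qed.

(** Both sides come from [1 - p <= e^{-p} <= 1 - p + p^2], raised to the power [n]. *)
Lemma expR_pow_approx (p : R) n : 0 <= p -> p <= 1 ->
  (1 - p) ^+ n <= expR (- (n%:R * p)) <= (1 - p) ^+ n + n%:R * p ^+ 2.
Proof.
move=> p0 p1; have h1 := expR_ge1Dx (- p).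
have -> : expR (- (n%:R * p)) = expR (- p) ^+ n by rewrite -mulrN expRM_natl.
apply/andP; split; first by rewrite lerXn2r ?nnegrE ?expR_ge0//; lra.
rewrite addrC -lerBlDr; apply: (le_trans (@powB_le (expR (- p)) (1 - p) n _ _ _));
  rewrite ?expR_le1; try lra.
rewrite ler_wpM2l//; have h2 := expR_ge1Dx p.
rewrite expRN; have : (expR p)^-1 <= (1 + p)^-1 by rewrite lef_pV2 ?posrE ?expR_gt0//; lra.
move=> h3; suff : (1 + p)^-1 <= 1 - p + p ^+ 2 by lra.
by rewrite -div1r ler_pdivrMr; [nra|lra].
Qed.

(* The scale [m] balances the box [in_box m], where pairs are only bounded
   trivially, against the decay of [gfun] outside it. *)
Definition scale (s L : R) := Num.truncn (expR (96 * s / d%:R * L)).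

Variables (K s : R).
(** Since [c2 = g0^-1], this makes [s = c2 / 384]: the box volume has exponent [96 s = c2 / 4] and
    the final rate is [12 s = c2 / 32]. *)
Hypotheses (K0 : 0 < K) (s0 : 0 < s) (s1 : 384 * s <= 1) (g0E : g0^-1 = 384 * s).

Let d3 : 3 <= d%:R :> R. Proof. by rewrite (ler_nat _ 3). Qed.

Lemma decay_scale L : 0 <= L -> decay d K (scale s L) <= 2 * K * expR (- (16 * s * L)).
Proof.
move=> L0; have d3' := d3; have s0' := s0.
rewrite /decay mulrA ler_pM2l ?mulr_gt0//.
set X := expR (96 * s / d%:R * L); set m := scale s L.
have Xm : X <= m.+1%:R by rewrite ltW// truncnS_gt.
rewrite powRN -[- _]opprK expRN opprK -/(powR _ _).
rewrite lef_pV2 ?posrE ?powR_gt0 ?expR_gt0 ?ltr0n//.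
apply: (@le_trans _ _ (X `^ ((d%:R - 2) / 2))); last first.
  by apply: ge0_ler_powR; rewrite ?nnegrE ?expR_ge0//; lra.
rewrite -expRM ler_expR.
have -> : 96 * s / d%:R * L * ((d%:R - 2) / 2) = (48 * (d%:R - 2) / d%:R) * (s * L).
  by field; rewrite gt_eqF//; lra.
rewrite -mulrA ler_wpM2r//; first by rewrite mulr_ge0// ltW.
(* What remains, [16 <= 48 (d - 2) / d], amounts to [d >= 3]. *)
by rewrite ler_pdivlMr; lra.
Qed.

Lemma box_scale L : 0 <= L ->
  ((2 * scale s L + 1) ^ d)%:R <= 3%:R ^+ d * expR (96 * s * L).
Proof.
move=> L0; have d3' := d3; have s0' := s0.
set X := expR (96 * s / d%:R * L).
have X1 : 1 <= X.
  rewrite -expR0 ler_expR mulr_ge0// divr_ge0//; lra.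
have mX : (scale s L)%:R <= X by rewrite truncn_le expR_ge0.
rewrite natrX natrD natrM.
have -> : expR (96 * s * L) = X ^+ d.
  by rewrite -expRM_natl; congr expR; field; rewrite gt_eqF//; lra.
rewrite -exprMn lerXn2r ?nnegrE//; lra.
Qed.

(** The bracket, scaled by [s^-2], collects the Poisson approximation, the near pairs and the far
    pairs. The last summand serves when [decay] exceeds [s]. *)
Definition error_const : R :=
  expR (2 * - ln s) * (1 + 3%:R ^+ d + 2 * K / s) + 2 * K / s.

Lemma error_bound (n : nat) (l q : R) : (2 <= n)%N -> 0 < l -> l <= ln n%:R ->
  0 <= q <= 1 ->
  let v := - ln (l / n%:R) in
  (forall m, decay d K m <= s ->
     (1 - expR (- v)) ^+ n <= q <= (1 - expR (- v)) ^+ n + n%:R * pair_bound d K s m n v) ->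
  `|q - expR (- l)| <= error_const * expR (- (12 * s * ln n%:R)).
Proof.
move=> n2 l0 ln_le /andP[q0 q1] v qP.
have s0' := s0; have s1' := s1; have K0' := K0.
set L := ln n%:R; set D := - ln s.
have N2 : 2 <= n%:R :> R by rewrite (ler_nat _ 2).
have N0 : 0 < n%:R :> R by lra.
have L0 : 0 <= L by rewrite ln_ge0//; lra.
have D0 : 0 <= D by rewrite oppr_ge0 ln_le0//; lra.
have NE : n%:R = expR L by rewrite lnK ?posrE.
have sL : 0 <= s * L by rewrite mulr_ge0// ltW.
have C1 : 0 <= expR (2 * D) * (1 + 3%:R ^+ d + 2 * K / s).
  rewrite mulr_ge0 ?expR_ge0// !addr_ge0 ?exprn_ge0 ?divr_ge0//; lra.
have Ks : 0 <= 2 * K / s by rewrite divr_ge0//; lra.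
rewrite /error_const -/D.
(* If the decay at this scale exceeds [s], then [2 K / s * n^(- 12 s)] is at least [1] and the claim
   is trivial. *)
have [dk|dk] := lerP (decay d K (scale s L)) s; last first.
  have h1 : s < 2 * K * expR (- (12 * s * L)).
    apply: lt_le_trans dk _; apply: le_trans (decay_scale L0) _.
    rewrite ler_pM2l ?ler_expR; lra.
  have h2 : 1 <= 2 * K / s * expR (- (12 * s * L)).
    by rewrite mulrAC ler_pdivlMr// mul1r ltW.
  have h3 : `|q - expR (- l)| <= 1.
    have := expR_ge0 (- l); have : expR (- l) <= 1 by rewrite expR_le1; lra.
    by rewrite ler_norml; lra.
  apply: le_trans h3 (le_trans h2 _).
  by rewrite ler_wpM2r ?expR_ge0// lerDr.
have p0 : 0 < l / n%:R by rewrite divr_gt0.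
have pE : expR (- v) = l / n%:R by rewrite opprK lnK ?posrE.
(* From [l <= ln n <= n^s / s] follows [e^{-v} <= s^-1 n^(s - 1)]: the logarithm costs a power [s]
   and the constant [D]. *)
have vD : - v <= D - (1 - s) * L.
  have Ls : s * L <= expR (s * L) by have := expR_ge1Dx (s * L); lra.
  have h1 : L <= expR (s * L + D).
    by rewrite expRD /D expRN lnK ?posrE// ler_pdivlMr// mulrC.
  rewrite opprK -ler_expR lnK ?posrE//.
  have -> : D - (1 - s) * L = s * L + D - L by ring.
  by rewrite expRB -NE ler_pM2r ?invr_gt0//; exact: le_trans h1.
have p1 : l / n%:R <= 1.
  rewrite ler_pdivrMr// mul1r; apply: le_trans ln_le _.
  by apply/ltW/ln_sublinear.
have := qP _ dk; rewrite pE => /andP[lo up].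
have := @expR_pow_approx (l / n%:R) n (ltW p0) p1.
rewrite mulrCA mulfV ?gt_eqF// mulr1 => /andP[lo' up'].
set E := expR (- (12 * s * L)).
(* The exponent of [n] is [1 - 2 (1 - s)], at most [- 12 s] because [384 s <= 1]. *)
have e1 : n%:R * (l / n%:R) ^+ 2 <= expR (2 * D) * E.
  rewrite -pE {1}NE -expRM_natl -!expRD ler_expR; nra.
(* The exponent of [n] is [1 + 96 s - (1 + 192 s) (1 - s) = 192 s^2 - 95 s], well below [- 12 s]. *)
have e2 : n%:R * (((2 * scale s L + 1) ^ d)%:R * expR (- (1 + g0^-1 / 2) * v)) <=
    expR (2 * D) * 3%:R ^+ d * E.
  apply: (@le_trans _ _ (expR L * (3%:R ^+ d * expR (96 * s * L) * expR (- (1 + g0^-1 / 2) * v)))).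
    by rewrite {1}NE ler_pM2l ?expR_gt0// ler_pM2r ?expR_gt0// box_scale.
  rewrite (_ : expR L * _ =
    3%:R ^+ d * (expR L * expR (96 * s * L) * expR (- (1 + g0^-1 / 2) * v))); last by ring.
  rewrite (_ : expR (2 * D) * _ * _ = 3%:R ^+ d * (expR (2 * D) * E)); last by ring.
  rewrite ler_wpM2l ?exprn_ge0// -!expRD ler_expR g0E.
  nra.
(* The exponent of [n] is [2 - 16 s - (2 - 2 s) (1 - s) = - 12 s - 2 s^2]; this term dictates the
   rate [12 s]. *)
have e3 : n%:R * (n%:R * (decay d K (scale s L) / s * expR (- (2 - 2 * s) * v))) <=
    expR (2 * D) * (2 * K / s) * E.
  have := decay_scale L0; set dk' := decay _ _ _ => hk.
  apply: (@le_trans _ _ (expR L * (expR L *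
    (2 * K * expR (- (16 * s * L)) / s * expR (- (2 - 2 * s) * v))))).
    rewrite {1 2}NE !ler_pM2l ?expR_gt0// ler_pM2r ?expR_gt0//.
    by rewrite ler_pM2r ?invr_gt0.
  rewrite (_ : expR L * _ =
    2 * K / s * (expR L * expR L * expR (- (16 * s * L)) * expR (- (2 - 2 * s) * v))); last by ring.
  rewrite (_ : expR (2 * D) * _ * _ = 2 * K / s * (expR (2 * D) * E)); last by ring.
  rewrite ler_wpM2l// -!expRD ler_expR.
  nra.
have EE : 0 <= 2 * K / s * E by rewrite mulr_ge0// expR_ge0.
have Z0 : 0 <= n%:R * (l / n%:R) ^+ 2 by rewrite mulr_ge0// ?sqr_ge0// ltW.
rewrite /pair_bound mulrDr in up.
rewrite ler_norml; lra.
Qed.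

End ErrorTerm.

(** * Cover levels *)

Section CoverLevel.
Variables (R : realType) (d : nat) (hd : (3 <= d)%N).
Local Notation g0 := (gfun R (0 : lattice d)).
Variable Px : lattice d -> probability (walk_path d) R.
Hypothesis PxP : is_simple_random_walk Px.
Context {dO : measure_display} {Omega : measurableType dO}.
Variable P : probability Omega R.
Local Notation space := (Wstar hd * measurableTypeR R)%type.
Variables (D : Omega -> set nat) (p : Omega -> nat -> space).
Hypothesis Dp : is_interlacement_process Px P D p.
Implicit Type A : {fset lattice d}.

Definition cover_le A (u : R) : set Omega := [set a | (cover_level D p A a <= u%:E)%E].

Lemma covered_mono A (u u' : R) : u <= u' -> covered D p A u `<=` covered D p A u'.
Proof.
move=> uu a h x /h[i [Di iu] ix]; exists i => //; split => //.
exact: le_trans uu.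
Qed.

Lemma covered_cover_le A u : 0 <= u -> covered D p A u `<=` cover_le A u.
Proof. by move=> u0 a h; apply: ereal_inf_lbound; exists u. Qed.

(** The strict inequality avoids having to know that the infimum defining [cover_level] is
    attained. *)
Lemma cover_le_covered A (u u' : R) : u < u' -> cover_le A u `<=` covered D p A u'.
Proof.
move=> uu a h.
have /ereal_inf_lt[_ [w [w0 hw] <-]] : (cover_level D p A a < u'%:E)%E.
  by apply: le_lt_trans h _; rewrite lte_fin.
by rewrite lte_fin => /ltW wu; exact: covered_mono wu _ hw.
Qed.

Lemma cover_le_eq0 A (u : R) : u < 0 -> cover_le A u = set0.
Proof.
move=> u0; rewrite -subset0 => a h.
have : (0 <= cover_level D p A a)%E.
  by apply: le_ereal_inf_tmp => _ [w [w0 _] <-]; rewrite lee_fin.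
by move=> /le_trans /(_ h); rewrite lee_fin leNgt u0.
Qed.

Lemma measurable_cover_le A u : measurable (cover_le A u).
Proof.
have [u0|u0] := ltP u 0; first by rewrite cover_le_eq0.
rewrite (_ : cover_le A u = \bigcap_k covered D p A (u + k.+1%:R^-1)).
  by apply: bigcapT_measurable => k; exact: (measurable_covered PxP Dp).
apply/seteqP; split => [a h k _|a h].
  by apply: cover_le_covered h; rewrite ltrDl.
apply/lee_addgt0Pr => e e0; have [k] := ltr_add_invr e0; rewrite add0r => ke.
apply: (@le_trans _ _ (u + k.+1%:R^-1)%:E).
  by apply: (covered_cover_le _ (h k I)); rewrite addr_ge0.
by rewrite -EFinD lee_fin lerD2l ltW.
Qed.

Lemma normalized_cover_levelE A z :
  [set a | (normalized_cover_level Px D p A a <= z%:E)%E] =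
  cover_le A ((z + ln #|` A|%:R) * g0).
Proof.
have g1 : 1 <= g0 := gfun0_ge1 (leq_trans (isT : 0 < 3)%N hd) (@transience R d hd).
have g0_gt0 : 0 < g0 by lra.
have key a : (normalized_cover_level Px D p A a <= z%:E)%E =
    (cover_level D p A a <= ((z + ln #|` A|%:R) * g0)%:E)%E.
  rewrite /normalized_cover_level (greenE hd PxP) subr0 leeBlDr//.
  by rewrite inver gt_eqF// lee_pdivrMr// -EFinD -EFinM.
by apply/seteqP; split => a; rewrite /cover_le /mkset key.
Qed.

Variables K s : R.
Hypotheses (K0 : 0 < K) (s0 : 0 < s) (s1 : 384 * s <= 1) (g0E : g0^-1 = 384 * s).
Hypothesis Kg : gfun_decay d K.

Lemma covered_error A l : let n := #|` A| in (2 <= n)%N -> 0 < l -> l <= ln n%:R ->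
  `|pr P (covered D p A (- ln (l / n%:R) * g0)) - expR (- l)| <=
  error_const d K s * expR (- (12 * s * ln n%:R)).
Proof.
move=> n n2 l0 ln_le.
have mC := measurable_covered PxP Dp A (- ln (l / n%:R) * g0).
apply: (error_bound hd K0 s0 s1 g0E n2 l0 ln_le).
  by rewrite pr_ge0 pr_le1.
move=> m dm; apply: (pr_covered_bounds PxP Dp A K0 Kg) => //.
rewrite oppr_ge0 ln_le0// ler_pdivrMr ?ltr0n; last by lia.
rewrite mul1r; apply: le_trans ln_le _; apply/ltW/ln_sublinear.
by rewrite ltr0n; lia.
Qed.

Lemma cover_le_error A l : let n := #|` A| in (2 <= n)%N -> 0 < l -> l <= ln n%:R ->
  `|pr P (cover_le A (- ln (l / n%:R) * g0)) - expR (- l)| <=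
  error_const d K s * expR (- (12 * s * ln n%:R)).
Proof.
move=> n n2 l0 ln_le; set E := error_const _ _ _ * _.
have N0 : 0 < n%:R :> R by rewrite ltr0n; lia.
have g1 : 1 <= g0 := gfun0_ge1 (leq_trans (isT : 0 < 3)%N hd) (@transience R d hd).
have mC u := measurable_covered PxP Dp A u.
have u0 : 0 <= - ln (l / n%:R) * g0.
  rewrite mulr_ge0//; last by lra.
  rewrite oppr_ge0 ln_le0// ler_pdivrMr// mul1r; apply: le_trans ln_le _.
  exact/ltW/ln_sublinear.
have lo := le_pr P (mC _) (measurable_cover_le A _) (covered_cover_le u0).
have := covered_error n2 l0 ln_le; rewrite -/n -/E !ler_norml => /andP[h1 _].
apply/andP; split; first by lra.
rewrite lerBlDr; apply/ler_addgt0Pr => e e0.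
(* A slightly smaller [l'] means a strictly higher level, where [cover_le_covered] applies. The
   bound [l / 2] keeps [l'] positive. *)
pose l' := Num.max (l - e) (l / 2).
have l'0 : 0 < l' by rewrite lt_max (divr_gt0 l0) ?orbT.
have l'l : l' < l by rewrite gt_max; apply/andP; split; lra.
have l'e : l - e <= l' by rewrite le_max lexx.
have uu : - ln (l / n%:R) * g0 < - ln (l' / n%:R) * g0.
  rewrite ltr_pM2r; last by lra.
  by rewrite ltrN2 ltr_ln ?posrE ?divr_gt0// ltr_pM2r ?invr_gt0.
have hi := le_pr P (measurable_cover_le A _) (mC _) (cover_le_covered uu).
have := covered_error n2 l'0 (le_trans (ltW l'l) ln_le).
rewrite -/n -/E ler_norml => /andP[_ h2].
have h3 : expR (- l') <= expR (- l) + e.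
  have a1 := expR_ge1Dx (l' - l).
  have a2 : expR (l' - l) * expR (- l') = expR (- l) by rewrite -expRD; congr expR; ring.
  have a3 : expR (- l') <= 1 by rewrite expR_le1; lra.
  have a4 := expR_gt0 (- l'); nra.
lra.
Qed.

Lemma gumbel_error A z : (2 <= #|` A|)%N ->
  `|pr P (cover_le A ((z + ln #|` A|%:R) * g0)) - gumbel_cdf z| <=
  (error_const d K s + 1) * expR (- (12 * s * ln #|` A|%:R)).
Proof.
set n := #|` A| => n2.
have s0' := s0; have s1' := s1; have K0' := K0.
have N2 : 2 <= n%:R :> R by rewrite (ler_nat _ 2).
have N0 : 0 < n%:R :> R by lra.
have L0 : 0 < ln n%:R :> R by rewrite ln_gt0//; lra.
have g1 : 1 <= g0 := gfun0_ge1 (leq_trans (isT : 0 < 3)%N hd) (@transience R d hd).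
rewrite /gumbel_cdf; set l := expR (- z); have l0 : 0 < l by exact: expR_gt0.
have -> : z + ln n%:R = - ln (l / n%:R).
  by rewrite ln_div ?posrE// expRK; ring.
rewrite mulrDl mul1r; set E := expR (- (12 * s * _)).
have E0 : 0 < E by exact: expR_gt0.
have [h|h] := lerP l (ln n%:R).
  apply: le_trans (cover_le_error n2 l0 h) _; rewrite lerDl; exact: ltW.
(* For [e^{-z} > ln n] both quantities are bounded, by monotonicity, by their values at [l = ln n].
   There [e^{-l} = 1 / n <= E], which accounts for the [+ 1] in the constant. *)
have := cover_le_error n2 L0 (lexx _); rewrite -/n -/E ler_norml => /andP[_ h1].
have e1 : expR (- ln n%:R) <= E.
  by rewrite ler_expR lerN2 ler_piMl// ?ltW//; lra.
have e2 : expR (- l) <= expR (- ln n%:R) by rewrite ler_expR lerN2 ltW.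
have e3 := expR_ge0 (- l).
have := pr_ge0 P (cover_le A (- ln (l / n%:R) * g0)).
have uu : - ln (l / n%:R) * g0 <= - ln (ln n%:R / n%:R) * g0.
  rewrite ler_pM2r; last by lra.
  by rewrite lerN2 ler_ln ?posrE ?divr_gt0// ler_pM2r ?invr_gt0// ltW.
have : pr P (cover_le A (- ln (l / n%:R) * g0)) <= pr P (cover_le A (- ln (ln n%:R / n%:R) * g0)).
  apply: le_pr; [exact: measurable_cover_le|exact: measurable_cover_le|].
  by move=> a /le_trans; apply; rewrite lee_fin.
have : 0 <= error_const d K s * E.
  by apply: le_trans (cover_le_error n2 L0 (lexx _)); exact: normr_ge0.
rewrite ler_norml; lra.
Qed.

End CoverLevel.

(** * The rate of convergence *)

Section Rate.
Variables (R : realType) (d : nat) (hd : (3 <= d)%N).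
Local Notation g0 := (gfun R (0 : lattice d)).
Variable Px : lattice d -> probability (walk_path d) R.
Hypothesis PxP : is_simple_random_walk Px.

Lemma gfun0_inv_itv : 0 < g0^-1 <= 1.
Proof.
have g1 : 1 <= g0 := gfun0_ge1 (leq_trans (isT : 0 < 3)%N hd) (@transience R d hd).
by rewrite invr_gt0 invf_le1 ?g1 ?(lt_le_trans ltr01 g1).
Qed.

(** The upper bound uses only the second term of the minimum in [c1], with [9 - c2 >= 8]. *)
Lemma c1_bounds : 0 < c1 Px <= g0^-1 / 32.
Proof.
have /andP[c0 cle1] := gfun0_inv_itv.
have d3 : 3 <= d%:R :> R by rewrite (ler_nat _ 3).
rewrite /c1 (c2E hd PxP); apply/andP; split.
  rewrite mulr_gt0// lt_min; apply/andP; split; last by rewrite divr_gt0//; lra.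
  by rewrite mulr_gt0// divr_gt0//; lra.
apply: (@le_trans _ _ (4^-1 * (g0^-1 / (9 - g0^-1)))).
  by rewrite ler_pM2l// ge_min lexx orbT.
have : g0^-1 / (9 - g0^-1) <= g0^-1 / 8 by rewrite ler_pM2l// lef_pV2 ?posrE; lra.
lra.
Qed.

Variable K : R.
Hypotheses (K0 : 0 < K) (Kg : gfun_decay d K).

Definition rate_const : R := error_const d K (g0^-1 / 384) + 1.

Lemma rate_const_ge1 : 1 <= rate_const.
Proof.
have /andP[c0 _] := gfun0_inv_itv; have K0' := K0.
have h : 0 <= 2 * K / (g0^-1 / 384) by rewrite divr_ge0//; lra.
rewrite lerDr /error_const addr_ge0// mulr_ge0 ?expR_ge0//.
by rewrite !addr_ge0// exprn_ge0.
Qed.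

Context {dO : measure_display} {Omega : measurableType dO}.
Variable P : probability Omega R.
Local Notation space := (Wstar hd * measurableTypeR R)%type.
Variables (D : Omega -> set nat) (p : Omega -> nat -> space).
Hypothesis Dp : is_interlacement_process Px P D p.

Lemma measurable_normalized_cover_level (A : {fset lattice d}) z :
  measurable [set a | (normalized_cover_level Px D p A a <= z%:E)%E].
Proof. rewrite (normalized_cover_levelE PxP); exact: (measurable_cover_le PxP Dp). Qed.

Lemma normalized_cover_level_rate (A : {fset lattice d}) z : A != fset0 ->
  `|pr P [set a | (normalized_cover_level Px D p A a <= z%:E)%E] - gumbel_cdf z|
  <= rate_const * #|` A|%:R `^ (- c1 Px).
Proof.
move=> A0; have /andP[c10 c1le] := c1_bounds; have /andP[c0 cle1] := gfun0_inv_itv.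
have r1 := rate_const_ge1.
have mC := measurable_normalized_cover_level A z.
have n1 : (1 <= #|` A|)%N by rewrite cardfs_gt0.
have [n2|n2] := leqP 2 #|` A|.
  rewrite (normalized_cover_levelE PxP).
  have h := @gumbel_error R d hd Px PxP _ _ P D p Dp K (g0^-1 / 384) K0.
  apply: le_trans (h _ _ _ Kg A z n2) _; [lra|lra|lra|].
  rewrite ler_pM2l; last by rewrite -/rate_const; lra.
  have N2 : 2 <= #|` A|%:R :> R by rewrite (ler_nat _ 2).
  rewrite /powR gt_eqF; last by lra.
  rewrite ler_expR mulNr lerN2 ler_wpM2r ?ln_ge0//; lra.
(* For a single point [ln n = 0] and the claimed bound is [rate_const >= 1], which any difference of
   two numbers in [[0, 1]] satisfies. *)
have -> : #|` A| = 1%N by lia.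
rewrite powR1 mulr1; apply: le_trans r1.
have := pr_ge0 P [set a | (normalized_cover_level Px D p A a <= z%:E)%E].
have := pr_le1 P mC; rewrite /gumbel_cdf; have := expR_ge0 (- expR (- z)).
have : expR (- expR (- z)) <= 1 by rewrite expR_le1 oppr_le0 expR_ge0.
rewrite ler_norml; lra.
Qed.

End Rate.

Theorem theorem0p1 (R : realType) (d : nat) (hd : (3 <= d)%N) :
  (exists2 c : R, 0 < c &
     forall (Px : lattice d -> probability (walk_path d) R)
       (dO : measure_display) (Omega : measurableType dO)
       (P : probability Omega R)
       (D : Omega -> set nat) (p : Omega -> nat -> Wstar hd * measurableTypeR R),
     is_simple_random_walk Px -> is_interlacement_process Px P D p ->
     forall A : {fset lattice d}, A != fset0 ->
       (ereal_sup [set `| P [set a | normalized_cover_level Px D p A a <= z%:E]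
                          - (gumbel_cdf z)%:E | | z in [set: R]]
        <= (c * #|` A|%:R `^ (- c1 Px))%:E)%E) /\
  (forall (Px : lattice d -> probability (walk_path d) R)
     (dO : measure_display) (Omega : measurableType dO)
     (P : probability Omega R)
     (D : Omega -> set nat) (p : Omega -> nat -> Wstar hd * measurableTypeR R),
   is_simple_random_walk Px -> is_interlacement_process Px P D p ->
   forall A : nat -> {fset lattice d},
     (fun n => #|` A n|) @ \oo --> \oo ->
     cvg_in_distribution P (fun n => normalized_cover_level Px D p (A n))
       (@gumbel_cdf R)).
Proof.
have [K K0 Kg] := gfun_decay_exists R hd; have r1 := rate_const_ge1 hd K0.
split.
  exists (rate_const d K); first by lra.
  move=> Px dO Omega P D p PxP Dp A A0; apply: ge_ereal_sup => _ [z _ <-].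
  rewrite (prE P (measurable_normalized_cover_level PxP Dp A z)).
  rewrite -EFinB abse_EFin lee_fin.
  exact: (normalized_cover_level_rate PxP K0 Kg Dp).
move=> Px dO Omega P D p PxP Dp A Aoo z _.
have mA n := measurable_normalized_cover_level PxP Dp (A n) z.
apply: cvg_EFin; first by near=> n; rewrite fin_num_measure.
apply/cvgrPdist_le => e e0.
have /andP[c10 _] := c1_bounds hd PxP.
set C := rate_const d K in r1.
near=> n.
(* Above the threshold [(C / e)^(1 / c1)] the error [C n^(- c1)] is at most [e]. *)
have nA : ((Num.truncn (expR (ln (C / e) / c1 Px))).+1 <= #|` A n|)%N.
  by near: n; move/cvgnyPge: Aoo; apply.
have An0 : A n != fset0 by rewrite -cardfs_gt0; lia.
have N0 : 0 < #|` A n|%:R :> R by rewrite ltr0n; lia.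
rewrite distrC; apply: le_trans (normalized_cover_level_rate PxP K0 Kg Dp z An0) _.
have Ce : 0 < C / e by rewrite divr_gt0//; lra.
rewrite -/C powRN ler_pdivrMr ?powR_gt0// -ler_pdivrMl// mulrC.
rewrite /powR (gt_eqF N0) -(lnK (_ : C / e \is Num.pos)) ?posrE// ler_expR.
rewrite [leRHS]mulrC -ler_pdivrMr// -ler_expR (lnK N0) ltW//.
by apply: lt_le_trans (truncnS_gt _) _; rewrite ler_nat.
Unshelve. all: by end_near. Qed.
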